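(* In the setting of Algorithm 2 (see context), suppose the basis functions $\eta_k$ are bounded, let $m:=\sup_{x\in\operatorname{supp}(X)}\sum_{k=1}^K|\eta_k(x)|^2$, and let $\tau=(1-\epsilon)\lambda_*$ for some $\epsilon\in(0,1)$. Then $$E\Big[\int_{\mathbb{R}^D}|y(x)-\hat y_L(x)|^2\mu(dx)\Big]\le\Big(1+\frac{\lambda^*}{\lambda_*(1-\epsilon)}\Big)\inf_{\alpha\in\mathbb{R}^K}\int_{\mathbb{R}^D}|y(x)-\alpha^\top\eta(x)|^2\mu(dx)$$ $$\qquad+2K\exp\Big\{-\frac{3\epsilon^2L}{6m\lambda^*/\lambda_*^2+2\epsilon(m/\lambda_*+\lambda^*/\lambda_* )}\Big\}\int_{\mathbb{R}^D}|y(x)|^2\mu(dx).$$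
   Context: $X$ is an $\mathbb{R}^D$-valued random variable with law $\mu$, $y:\mathbb{R}^D\to\mathbb{R}$ is measurable and square integrable w.r.t. $\mu$, $Y=y(X)$, and $(X^{(l)},Y^{(l)})_{l=1,\dots,L}$ are i.i.d. copies of $(X,Y)$. $\eta=(\eta_1,\dots,\eta_K)^\top$ is a vector of measurable functions square integrable w.r.t. $\mu$, $R=(E[\eta_k(X)\eta_\kappa(X)])_{k,\kappa=1}^K$ has full rank, and $0<\lambda_*\le\lambda_{\min}(R)\le\lambda_{\max}(R)\le\lambda^*<\infty$. Algorithm 2 with threshold $\tau>0$: form the $L\times K$ matrix $A=(\eta_k(X^{(l)}))_{l,k}$ with singular values $s_1\ge\dots\ge s_K\ge0$; if $s_K^2\ge L\tau$ set $\alpha_L=A^+(Y^{(1)},\dots,Y^{(L)})^\top$ ($A^+$ the Moore–Penrose pseudoinverse, i.e. the least-squares coefficient vector), otherwise $\alpha_L=0\in\mathbb{R}^K$; return $\hat y_L(x)=\alpha_L^\top\eta(x)$. $\operatorname{supp}(X)$ is the set of $x$ such that every ball around $x$ is hit by $X$ with positive probability. *)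

(* Defs.v *)
From HB Require Import structures.
From mathcomp Require Import all_boot all_order all_algebra.
From mathcomp Require Import all_classical all_reals all_analysis.
Set Implicit Arguments. Unset Strict Implicit. Unset Printing Implicit Defensive.
Import Order.TTheory GRing.Theory Num.Theory.
Local Open Scope classical_set_scope.
Local Open Scope ring_scope.

(* R^D is represented by D.-tuple R, equipped with the library's product
   sigma-algebra (generated by the coordinate maps), i.e. the Borel sets of R^D. *)

Section Defs.
Context {R : realType}.

(* Moore--Penrose pseudoinverse: the (unique) B satisfying the four Penrose
   equations (real matrices, so conjugate transpose = transpose). *)
Definition penrose (m n : nat) (A : 'M[R]_(m, n)) (B : 'M[R]_(n, m)) : Prop :=
  [/\ A *m B *m A = A, B *m A *m B = B,
      (A *m B)^T = A *m B & (B *m A)^T = B *m A].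

Definition mp_pinv (m n : nat) (A : 'M[R]_(m, n)) : 'M[R]_(n, m) :=
  xget 0 [set B | penrose A B].

(* The squares s_1^2 >= ... >= s_K^2 of the singular values of A : L x K are
   the eigenvalues of A^T A (with multiplicity). *)
Definition sq_singular_values (m n : nat) (A : 'M[R]_(m, n)) : set R :=
  [set a | eigenvalue (A^T *m A) a].

Definition smallest_sq_sv_ge (m n : nat) (A : 'M[R]_(m, n)) (c : R) : Prop :=
  forall a, sq_singular_values A a -> c <= a.

Definition design_matrix (L K D : nat) (eta : 'I_K -> D.-tuple R -> R)
  (xs : 'I_L -> D.-tuple R) : 'M[R]_(L, K) :=
  \matrix_(l < L, k < K) eta k (xs l).

Definition alg2_coef (L K D : nat) (eta : 'I_K -> D.-tuple R -> R) (tau : R)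
  (xs : 'I_L -> D.-tuple R) (ys : 'cV[R]_L) : 'cV[R]_K :=
  let A := design_matrix eta xs in
  if `[< smallest_sq_sv_ge A (L%:R * tau) >] then mp_pinv A *m ys else 0.

Definition alg2 (L K D : nat) (eta : 'I_K -> D.-tuple R -> R) (tau : R)
  (xs : 'I_L -> D.-tuple R) (ys : 'cV[R]_L) (x : D.-tuple R) : R :=
  \sum_(k < K) alg2_coef eta tau xs ys k ord0 * eta k x.

Definition gram (D K : nat) (mu : {measure set (D.-tuple R) -> \bar R})
  (eta : 'I_K -> D.-tuple R -> R) : 'M[R]_K :=
  \matrix_(k < K, j < K) Rintegral mu setT (fun x => eta k x * eta j x).

(* support of a measure on R^D: points all of whose balls have positive
   measure (balls w.r.t. the sup-norm; these generate the same topology as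
   Euclidean balls, so the support is the same set). *)
Definition supp (D : nat) (mu : set (D.-tuple R) -> \bar R) : set (D.-tuple R) :=
  [set x : D.-tuple R | forall r : R, (0 < r)%R ->
     (0 < mu [set z : D.-tuple R | forall i : 'I_D,
                 (`|tnth z i - tnth x i| < r)%R])%E].

Definition mutually_independent (d : measure_display) (Omega : measurableType d)
  (P : probability Omega R) (L D : nat) (X : 'I_L -> Omega -> D.-tuple R) : Prop :=
  forall A : 'I_L -> set (D.-tuple R), (forall l, measurable (A l)) ->
    P (\bigcap_(l in [set: 'I_L]) (X l @^-1` A l)) =
    (\prod_(l < L) P (X l @^-1` A l))%E.

End Defs.

(* Main.v *)
Require Import Defs.
From HB Require Import structures.
From mathcomp Require Import all_boot all_order all_algebra all_fingroup.
From mathcomp Require Import complex.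
From mathcomp Require Import all_classical all_reals all_analysis.
From mathcomp Require Import measurable_realfun ring lra.
Set Implicit Arguments. Unset Strict Implicit. Unset Printing Implicit Defensive.
Import Order.TTheory GRing.Theory Num.Theory.
Import numFieldNormedType.Exports.
Local Open Scope classical_set_scope.
Local Open Scope ring_scope.

(** The population risk is a quadratic function of the coefficients, so it equals
    its minimum plus [(a - a0) G (a - a0)^T], with [G] the Gram matrix.  When the
    design is well conditioned, the least-squares error [alpha_L - a0] is at most
    [|Y - A a0|^2 / (L tau)] in squared norm; otherwise the estimator vanishes.  It
    remains to bound the probability of an ill-conditioned design.

    Whiten the features, so that [G] becomes the identity and the squared norm of the
    feature vector is at most [m / lam_lo].  Let [S] be the sum of the centred matrices
    [1 - g(X_l)^T g(X_l)].  An ill-conditioned design forces [tr (exp (c S))] to be at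
    least [exp (c eps L)].  Its mean [M(c)] is bounded by the method of exchangeable
    pairs (Mackey, Jordan, Chen, Farrell and Tropp), which needs no Golden-Thompson
    inequality: exchange one sample with an independent copy and apply
    [2 tr ((A - B) (e^A - e^B)) <= tr ((A - B)^2 (e^A + e^B))] to get
    [E tr (S e^(cS)) <= c (m / lam_lo) L M(c)].  By convexity this bounds the increments
    of [M], hence [M(c) <= 2 K exp (c^2 (m / lam_lo) L / 2)].  Taking
    [c = eps / (m / lam_lo)] gives an exponent better than the one required. *)

(** * Spectral theorem for real symmetric matrices *)

(** Over [R[i]] the matrix is Hermitian, hence unitarily diagonalizable with real spectrum; a real
    eigenvalue of the complexified matrix descends to [A]. *)
Lemma symmetric_eigenvalue_exists (R : rcfType) (n : nat) (A : 'M[R]_n.+1) :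
  A^T = A -> exists a, eigenvalue A a.
Proof.
move=> symA; pose f : {rmorphism R -> R[i]} := real_complex R.
pose B := map_mx f A.
have hermB : B \is hermsymmx.
  apply: realsym_hermsym.
    by apply/is_hermitianmxP; rewrite expr0 scale1r map_mx_id// map_trmx symA.
  apply/mxOverP => i j; rewrite mxE /f /=; by apply/complex_realP; exists (A i j).
have /orthomx_spectralP BE := hermitian_normalmx hermB.
have /mxOverP/(_ ord0 ord0) dreal := hermitian_spectral_diag_real hermB.
have [a da] : exists a : R, spectral_diag B 0 0 = f a.
  by have /complex_realP := dreal.
exists a; rewrite -(eigenvalue_map f) -da.
have Punit := spectral_unit B.
apply/eigenvalueP; exists (row 0 (spectralmx B)).
  rewrite -row_mul [X in _ *m X]BE !mulmxA mulmxV// mul1mx.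
  by rewrite row_mul row_diag_mx -scalemxAl -rowE.
apply/eqP => /(congr1 (fun v => v *m invmx (spectralmx B))).
rewrite -row_mul mulmxV// mul0mx => /rowP/(_ ord0).
by rewrite !mxE eqxx => /eqP; rewrite oner_eq0.
Qed.

Definition sqn (R : pzRingType) n (u : 'rV[R]_n) : R := \sum_i u 0 i ^+ 2.

Lemma sqnE (R : pzRingType) n (u : 'rV[R]_n) : u *m u^T = (sqn u)%:M.
Proof.
by apply/rowP => i; rewrite !ord1 !mxE mulr1n; apply: eq_bigr => j _; rewrite mxE.
Qed.

Lemma sqn_ge0 (R : realDomainType) n (u : 'rV[R]_n) : 0 <= sqn u.
Proof. by apply: sumr_ge0 => i _; exact: sqr_ge0. Qed.

Lemma sqn_eq0 (R : realDomainType) n (u : 'rV[R]_n) : (sqn u == 0) = (u == 0).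
Proof.
apply/eqP/eqP => [|->]; last by rewrite /sqn big1// => i _; rewrite mxE expr0n.
move=> /psumr_eq0P h; apply/rowP => i; rewrite mxE.
by apply/eqP; rewrite -sqrf_eq0 h// => j _; exact: sqr_ge0.
Qed.

Lemma sqnZ (R : comPzRingType) n (c : R) (u : 'rV[R]_n) : sqn (c *: u) = c ^+ 2 * sqn u.
Proof. by rewrite /sqn mulr_sumr; apply: eq_bigr => i _; rewrite mxE exprMn. Qed.

(* Householder reflection: the symmetry exchanging [u] and the first basis vector. *)
Lemma orthogonal_completion (R : realFieldType) n (u : 'rV[R]_n.+1) : sqn u = 1 ->
  exists H : 'M[R]_n.+1, [/\ H *m H = 1%:M, H^T = H & row 0 H = u].
Proof.
move=> u1; pose e : 'rV[R]_n.+1 := delta_mx 0 0.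
(* The reflection along [u - e] degenerates when [u = e]; the identity serves there. *)
have [->|une] := eqVneq u e.
  by exists 1%:M; rewrite mulmx1 trmx1 rowE mulmx1.
pose v := u - e; pose s := sqn v.
have s0 : s != 0 by rewrite sqn_eq0 subr_eq0.
have ee : e *m e^T = 1%:M.
  by rewrite trmx_delta mul_delta_mx; apply/rowP => i; rewrite !ord1 !mxE eqxx.
have uu : u *m u^T = 1%:M by rewrite sqnE u1.
have ue : u *m e^T = (u 0 0)%:M.
  rewrite trmx_delta; apply/rowP => i; rewrite !ord1 !mxE (bigD1 ord0)//= !mxE eqxx.
  by rewrite big1 ?addr0 ?mulr1 ?mulr1n// => j /negPf nj; rewrite !mxE nj mulr0.
have eu : e *m u^T = (u 0 0)%:M.
  by rewrite -[LHS]trmxK trmx_mul trmxK ue tr_scalar_mx.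
have sE : s = 2 - 2 * u 0 0.
  have := sqnE v; rewrite /v linearB /= mulmxBl !mulmxBr uu ue eu ee.
  move=> /rowP/(_ 0); rewrite !mxE eqxx !mulr1n -/v -/s => <-; ring.
have ev : e *m v^T = (u 0 0 - 1)%:M by rewrite linearB /= mulmxBr eu ee -raddfB.
exists (1%:M - (2 / s) *: (v^T *m v)); split.
- have : (v^T *m v) *m (v^T *m v) = s *: (v^T *m v).
    by rewrite mulmxA -[v^T *m v *m v^T]mulmxA sqnE mul_mx_scalar -scalemxAl.
  move: (v^T *m v) => Q QQ.
  rewrite mulmxBl !mulmxBr mul1mx !mulmx1 mul1mx -!scalemxAl -!scalemxAr scalerA QQ.
  rewrite scalerA -addrA -opprD -[RHS]subr0; congr (_ - _).
  rewrite addrA -scalerDl -scalerBl (_ : _ - _ = 0) ?scale0r//.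
  by field.
- by rewrite linearB /= linearZ /= trmx1 trmx_mul trmxK.
- rewrite rowE mulmxBr mulmx1 -scalemxAr mulmxA -/e ev mul_scalar_mx scalerA.
  have -> : 2 / s * (u 0 0 - 1) = -1.
    have -> : u 0 0 - 1 = - (s / 2) by rewrite sE; field.
    by field.
  by rewrite scaleN1r opprK /v addrC subrK.
Qed.

(** Deflation: conjugating by a reflection whose first row is a unit eigenvector splits off a block
    of size one. Both factors sit in one pair so that [eigendecomposition] can choose them
    together. *)
Theorem real_spectral (R : rcfType) n (A : 'M[R]_n) : A^T = A ->
  exists p : 'M[R]_n * 'rV[R]_n,
    p.1 *m p.1^T = 1%:M /\ A = p.1^T *m diag_mx p.2 *m p.1.
Proof.
elim: n A => [|n IH] A symA.
  by exists (1%:M, 0); split=> //=; apply/matrixP => -[].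
have [a /eigenvalueP[v vA v0]] := symmetric_eigenvalue_exists symA.
pose u := (Num.sqrt (sqn v))^-1 *: v.
have uA : u *m A = a *: u by rewrite -scalemxAl vA scalerA mulrC -scalerA.
have u1 : sqn u = 1.
  by rewrite sqnZ exprVn sqr_sqrtr ?sqn_ge0// mulVf// sqn_eq0.
have [H [HH Ht H0]] := orthogonal_completion u1.
pose B : 'M[R]_(1 + n) := H *m A *m H.
have symB : B^T = B by rewrite /B !trmx_mul symA Ht mulmxA.
have B0 : row 0 B = a *: delta_mx 0 0.
  by rewrite /B !row_mul H0 uA -scalemxAl -H0 -row_mul HH rowE mulmx1.
have AE : A = H *m B *m H by rewrite /B !mulmxA HH mul1mx -mulmxA HH mulmx1.
clearbody B.
(* The first row of [B] vanishes off the diagonal, and by symmetry so does the first column. *)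
have BE : B = block_mx a%:M 0 0 (drsubmx B).
  rewrite -[LHS]submxK; congr block_mx.
  - apply/matrixP => i j; rewrite !ord1.
    have /rowP/(_ 0) := B0; rewrite !mxE => E.
    by rewrite !(lshift0, eqxx) // E eqxx mulr1 mulr1n.
  - apply/matrixP => i j; rewrite !ord1.
    have /rowP/(_ (rshift 1 j)) := B0; rewrite !mxE => E.
    by rewrite !(lshift0) E mulr0.
  - apply/matrixP => i j; rewrite !ord1.
    have /rowP/(_ (rshift 1 i)) := B0; rewrite !mxE mulr0 => E.
    by rewrite lshift0; transitivity (B^T (rshift 1 i) ord0); [by rewrite symB|rewrite mxE; exact: E].
have [|[V d] /= [V1 dE]] := IH (drsubmx B).
  by rewrite trmx_drsub symB.
pose W : 'M[R]_(1 + n) := block_mx 1%:M 0 0 V.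
have WT : W^T = block_mx 1%:M 0 0 V^T :> 'M[R]_(1 + n).
  by rewrite /W tr_block_mx !trmx0 trmx1.
have W1 : W *m W^T = 1%:M.
  rewrite WT /W mulmx_block V1 !mulmx0 !mul0mx !mulmx1.
  by rewrite !addr0 add0r -scalar_mx_block.
have WD : W^T *m diag_mx (row_mx a%:M d) *m W = B.
  rewrite [RHS]BE dE diag_mx_row WT /W !mulmx_block.
  rewrite !(mulmx0, mul0mx, mulmx1, mul1mx, addr0, add0r).
  congr block_mx; apply/matrixP => i j; by rewrite !ord1 !mxE eqxx.
clearbody W; exists (W *m H, row_mx a%:M d); split => /=.
  by rewrite trmx_mul Ht mulmxA -[W *m H *m H]mulmxA HH mulmx1.
by rewrite AE trmx_mul Ht -WD !mulmxA.
Qed.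

(** * Matrix exponential and trace inequalities *)

(** The Padé bound [exp d <= (2 + d) / (2 - d)], multiplied out so that it also covers [2 <= d]. The
    derivative [(1 - x) exp x - 1] of the difference is nonpositive because [1 - x <= exp (- x)]. *)
Lemma expR_pade_le (R : realType) (d : R) : 0 <= d -> (2 - d) * expR d <= 2 + d.
Proof.
move=> d0; pose g : R -> R := fun x => (2 - x) * expR x - (2 + x).
have dg (x : R) : is_derive x (1 : R) g ((1 - x) * expR x - 1).
  by apply: is_derive_eq; rewrite /GRing.scale /=; ring.
have : g d <= g 0.
  apply: (@ler0_derive1_nincr _ g 0 d) => //.
  - move=> x _; rewrite derive1E (@derive_val _ _ _ _ _ _ _ (dg x)) subr_le0.
    have := expR_ge1Dx (- x); rewrite expRN => h.
    rewrite -ler_pdivlMr ?expR_gt0// mul1r; exact: h.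
  - by apply: derivable_within_continuous => x _; exact: (@ex_derive _ _ _ _ _ _ _ (dg x)).
by rewrite /g expR0 subr0 addr0 mulr1 subrr subr_le0.
Qed.

Section diagonalization.
Variable R : comPzRingType.

Definition spectral_sum n (U : 'M[R]_n) (a : 'rV[R]_n) : 'M[R]_n :=
  U^T *m diag_mx a *m U.

Lemma spectral_sumM n (U : 'M[R]_n) a b : U *m U^T = 1%:M ->
  spectral_sum U a *m spectral_sum U b = spectral_sum U (map2_mx *%R a b).
Proof.
move=> U1; rewrite /spectral_sum !mulmxA -[_ *m U *m U^T]mulmxA U1 mulmx1.
rewrite -[_ *m _ *m diag_mx b]mulmxA mulmx_diag; congr (_ *m diag_mx _ *m _).
by apply/rowP => i; rewrite !mxE.
Qed.

Lemma mxE_spectral_sum n (U : 'M[R]_n) a i j :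
  spectral_sum U a i j = \sum_k a 0 k * (U k i * U k j).
Proof.
rewrite /spectral_sum mul_mx_diag !mxE; apply: eq_bigr => k _; rewrite !mxE.
ring.
Qed.

Lemma spectral_sum_form n (U : 'M[R]_n) a (u : 'rV[R]_n) :
  u *m spectral_sum U a *m u^T = (\sum_k a 0 k * (u *m U^T) 0 k ^+ 2)%:M.
Proof.
have -> : u *m spectral_sum U a *m u^T = (u *m U^T) *m diag_mx a *m (u *m U^T)^T.
  by rewrite /spectral_sum trmx_mul trmxK !mulmxA.
move: (u *m U^T) => w; rewrite mul_mx_diag; apply/rowP => i.
rewrite !ord1 !mxE mulr1n; apply: eq_bigr => k _; rewrite !mxE; ring.
Qed.

(** The squared entries of [U V^T] are overlap weights between two eigenbases. Trace inequalities
    for noncommuting matrices thereby reduce to scalar inequalities on pairs of eigenvalues. *)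
Lemma mxtrace_spectral_sumM n (U V : 'M[R]_n) a b :
  \tr (spectral_sum U a *m spectral_sum V b) =
  \sum_i \sum_j a 0 i * b 0 j * (U *m V^T) i j ^+ 2.
Proof.
transitivity (\tr (diag_mx a *m (U *m V^T) *m (diag_mx b *m (U *m V^T)^T))).
  by rewrite /spectral_sum trmx_mul trmxK -!mulmxA mxtrace_mulC !mulmxA.
move: (U *m V^T) => W; rewrite !mul_diag_mx /mxtrace; apply: eq_bigr => i _.
rewrite !mxE; apply: eq_bigr => j _; rewrite !mxE; ring.
Qed.

Lemma sqn_orthogonal n (U : 'M[R]_n) (u : 'rV[R]_n) :
  U *m U^T = 1%:M -> sqn (u *m U^T) = sqn u.
Proof.
move=> /mulmx1C U1; have := sqnE (u *m U^T).
by rewrite trmx_mul trmxK mulmxA -[u *m _ *m U]mulmxA U1 mulmx1 sqnE =>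
  /rowP/(_ 0); rewrite !mxE !mulr1n.
Qed.

End diagonalization.

Section matrix_exponential.
Variable R : realType.

Definition eigendecomposition n (A : 'M[R]_n) : 'M[R]_n * 'rV[R]_n :=
  xget (1%:M, 0) [set p | p.1 *m p.1^T = 1%:M /\ A = spectral_sum p.1 p.2].

(** Exponential by functional calculus. A nonsymmetric matrix has no orthogonal eigendecomposition;
    the default pair then yields the identity. *)
Definition expmx n (A : 'M[R]_n) : 'M[R]_n :=
  spectral_sum (eigendecomposition A).1 (map_mx expR (eigendecomposition A).2).

Lemma expmx_spectral n (A : 'M[R]_n) : A^T = A ->
  exists U a, [/\ U *m U^T = 1%:M, A = spectral_sum U a &
                  expmx A = spectral_sum U (map_mx expR a)].
Proof.
move=> symA; have [p pP] := real_spectral symA.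
have [U1 AE] := @xgetI _ (1%:M, 0) [set p | p.1 *m p.1^T = 1%:M /\ A = spectral_sum p.1 p.2] p pP.
by exists (eigendecomposition A).1, (eigendecomposition A).2; split.
Qed.

Lemma spectral_sum_const1 n (U : 'M[R]_n) : U *m U^T = 1%:M ->
  spectral_sum U (const_mx 1) = 1%:M.
Proof.
by move=> /mulmx1C U1; rewrite /spectral_sum diag_const_mx mulmx1.
Qed.

(** Inserting the identity, resolved in the basis [V], spreads a trace in [U] alone over the overlap
    weights, so that it can be compared termwise with mixed traces. *)
Lemma mxtrace_spectral_sum n (U V : 'M[R]_n) a : V *m V^T = 1%:M ->
  \tr (spectral_sum U a) = \sum_i \sum_j a 0 i * (U *m V^T) i j ^+ 2.
Proof.
move=> V1; rewrite -[spectral_sum U a]mulmx1 -(spectral_sum_const1 V1).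
rewrite mxtrace_spectral_sumM; apply: eq_bigr => i _; apply: eq_bigr => j _.
by rewrite mxE mulr1.
Qed.

Lemma mxtrace_spectral_sumr n (U V : 'M[R]_n) b : U *m U^T = 1%:M ->
  \tr (spectral_sum V b) = \sum_i \sum_j b 0 j * (U *m V^T) i j ^+ 2.
Proof.
move=> U1; rewrite -[spectral_sum V b]mul1mx -(spectral_sum_const1 U1).
rewrite mxtrace_spectral_sumM; apply: eq_bigr => i _; apply: eq_bigr => j _.
by rewrite mxE mul1r.
Qed.

(** The trapezoid rule overestimates the integral of the convex function [exp] between [b] and
    [a]. *)
Lemma expR_trapezoid (a b : R) :
  2 * ((a - b) * (expR a - expR b)) <= (a - b) ^+ 2 * (expR a + expR b).
Proof.
wlog ab : a b / b <= a.
  move=> h; have [/h//|/ltW/h] := leP b a.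
  rewrite -subr_ge0 => h'; rewrite -subr_ge0; apply: le_trans h' _.
  by rewrite le_eqVlt; apply/orP; left; apply/eqP; ring.
(* Factoring out [exp b] leaves the Padé bound at [a - b]. *)
have -> : expR a = expR b * expR (a - b) by rewrite -expRD addrC subrK.
have := expR_gt0 b; have : 0 <= a - b by rewrite subr_ge0.
move: (a - b) (expR b) => c e c0 e0.
have := expR_pade_le c0; rewrite -subr_ge0 => h.
rewrite -subr_ge0 (_ : _ - _ = e * (c * (2 + c - (2 - c) * expR c))); last by ring.
by rewrite !mulr_ge0// ltW.
Qed.

(** Klein's inequality: the tangent bound [exp b >= exp a * (1 + b - a)] on pairs of eigenvalues,
    summed with the overlap weights. *)
Lemma klein_expmx n (A B : 'M[R]_n) : A^T = A -> B^T = B ->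
  \tr (expmx A) - \tr (expmx B) <= \tr ((A - B) *m expmx A).
Proof.
move=> /expmx_spectral[U [a [U1 AE ->]]] /expmx_spectral[V [b [V1 BE ->]]].
rewrite mulmxBl [in leRHS]linearB /=.
rewrite [\tr (B *m _)]mxtrace_mulC AE BE spectral_sumM//.
rewrite !(mxtrace_spectral_sum U _ V1) (mxtrace_spectral_sumr V _ U1).
rewrite mxtrace_spectral_sumM -!sumrB; apply: ler_sum => i _.
rewrite -!sumrB; apply: ler_sum => j _; rewrite !mxE -!mulrBl.
apply: ler_wpM2r; first exact: sqr_ge0.
have := expR_ge1Dx (b 0 j - a 0 i); have := expR_gt0 (a 0 i).
have -> : expR (b 0 j) = expR (a 0 i) * expR (b 0 j - a 0 i).
  by rewrite -expRD addrC subrK.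
nra.
Qed.

Lemma mxtrace_trapezoid n (A B : 'M[R]_n) : A^T = A -> B^T = B ->
  2 * \tr ((A - B) *m (expmx A - expmx B)) <=
  \tr ((A - B) *m (A - B) *m (expmx A + expmx B)).
Proof.
move=> /expmx_spectral[U [a [U1 AE ->]]] /expmx_spectral[V [b [V1 BE ->]]].
set EA := spectral_sum U (map_mx _ _); set EB := spectral_sum V (map_mx _ _).
have trB (M N : 'M[R]_n) : \tr (M - N) = \tr M - \tr N by exact: raddfB.
have trD (M N : 'M[R]_n) : \tr (M + N) = \tr M + \tr N by exact: raddfD.
have EL : \tr ((A - B) *m (EA - EB)) =
    \tr (A *m EA) - \tr (A *m EB) - \tr (EA *m B) + \tr (B *m EB).
  rewrite mulmxBl !mulmxBr !trB [\tr (B *m EA)]mxtrace_mulC; ring.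
(* Cyclicity of the trace gathers all functions of [A] on one side and all functions of [B] on the
   other, so each term becomes a double sum over eigenvalue pairs. *)
have ER : \tr ((A - B) *m (A - B) *m (EA + EB)) =
   \tr (A *m A *m EA) - \tr ((EA *m A) *m B) - \tr ((A *m EA) *m B)
   + \tr (EA *m (B *m B)) + (\tr (A *m A *m EB) - \tr (A *m (B *m EB))
     - \tr (A *m (EB *m B)) + \tr (B *m B *m EB)).
  rewrite !(mulmxBl, mulmxBr, mulmxDr) !(trB, trD).
  rewrite -[EA *m A *m B]mulmxA [\tr (EA *m (A *m B))]mxtrace_mulC.
  rewrite -[A *m EA *m B]mulmxA [\tr (A *m (EA *m B))]mxtrace_mulC.
  rewrite -[EA *m B *m A]mulmxA [\tr (EA *m (B *m A))]mxtrace_mulC.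
  rewrite [\tr (EA *m (B *m B))]mxtrace_mulC.
  rewrite [A *m (EB *m B)]mulmxA [\tr (A *m EB *m B)]mxtrace_mulC.
  rewrite !mulmxA; ring.
rewrite EL ER /EA /EB AE BE !spectral_sumM//.
rewrite !(mxtrace_spectral_sum U _ V1) !(mxtrace_spectral_sumr V _ U1).
rewrite !mxtrace_spectral_sumM -!(sumrB, big_split) /=.
rewrite mulr_sumr; apply: ler_sum => i _.
rewrite -!(sumrB, big_split) /= mulr_sumr; apply: ler_sum => j _.
have := sqr_ge0 ((U *m V^T) i j); move: ((U *m V^T) i j ^+ 2) => w w0.
rewrite !mxE -subr_ge0.
have := expR_trapezoid (a 0 i) (b 0 j); rewrite -subr_ge0 => /(mulr_ge0 w0).
move=> h; apply: le_trans h _.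
by rewrite le_eqVlt; apply/orP; left; apply/eqP; ring.
Qed.

Lemma expmx_form_ge0 n (A : 'M[R]_n) (u : 'rV[R]_n) : A^T = A ->
  0 <= (u *m expmx A *m u^T) 0 0.
Proof.
move=> /expmx_spectral[U [a [U1 AE ->]]].
rewrite spectral_sum_form mxE mulr1n; apply: sumr_ge0 => k _.
by rewrite mxE mulr_ge0 ?sqr_ge0 ?expR_ge0.
Qed.

Lemma mxtrace_expmx_ge0 n (A : 'M[R]_n) : A^T = A -> 0 <= \tr (expmx A).
Proof.
move=> symA; apply: sumr_ge0 => i _.
have := expmx_form_ge0 (delta_mx 0 i) symA.
by rewrite -rowE trmx_delta -colE !mxE.
Qed.

(** A Rayleigh quotient of at least [c] forces an eigenvalue of at least [c], and the trace of the
    exponential dominates each of its eigenvalues. *)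
Lemma expR_le_mxtrace n (A : 'M[R]_n) (u : 'rV[R]_n) c : A^T = A -> u != 0 ->
  c * sqn u <= (u *m A *m u^T) 0 0 -> expR c <= \tr (expmx A).
Proof.
move=> /expmx_spectral[U [a [U1 AE ->]]] u0.
rewrite AE spectral_sum_form mxE mulr1n -(sqn_orthogonal _ U1) => h.
have trE : \tr (spectral_sum U (map_mx expR a)) = \sum_i expR (a 0 i).
  rewrite /spectral_sum -mulmxA mxtrace_mulC -mulmxA U1 mulmx1 mxtrace_diag.
  by apply: eq_bigr => i _; rewrite mxE.
rewrite trE; have [[i hi]|none] := pselect (exists i, c <= a 0 i).
  rewrite (bigD1 i)//=; apply: (@le_trans _ _ (expR (a 0 i))); first by rewrite ler_expR.
  by rewrite lerDl; apply: sumr_ge0 => j _; exact: expR_ge0.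
(* If all eigenvalues were below [c], a nonzero coordinate of [u] in the eigenbasis would make the
   Rayleigh quotient strictly smaller than [c]. *)
exfalso; have ai i : a 0 i < c.
  by rewrite ltNge; apply/negP => ?; apply: none; exists i.
have w0 : u *m U^T != 0.
  by rewrite -sqn_eq0 sqn_orthogonal// sqn_eq0.
have [i wi] : exists i, (u *m U^T) 0 i != 0.
  apply/existsP; apply: contraNT w0; rewrite negb_exists => /forallP w0.
  by apply/eqP/rowP => i; rewrite [RHS]mxE; apply/eqP; have := w0 i; rewrite negbK.
have : \sum_k a 0 k * (u *m U^T) 0 k ^+ 2 < c * sqn (u *m U^T).
  rewrite /sqn mulr_sumr; rewrite [ltLHS](bigD1 i)//= [ltRHS](bigD1 i)//=.
  apply: ltr_leD; first by rewrite ltr_pM2r// exprn_even_gt0.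
  by apply: ler_sum => k _; rewrite ler_wpM2r ?sqr_ge0// ltW.
by rewrite ltNge h.
Qed.

Lemma expmx_entry_le n (A : 'M[R]_n) c i j : A^T = A ->
  (forall u : 'rV[R]_n, (u *m A *m u^T) 0 0 <= c * sqn u) ->
  `|expmx A i j| <= n%:R * expR c.
Proof.
move=> /expmx_spectral[U [a [U1 AE ->]]] h.
have ac k : a 0 k <= c.
  have := h (row k U); rewrite AE spectral_sum_form mxE mulr1n.
  have E l : (row k U *m U^T) 0 l = (k == l)%:R by rewrite -row_mul U1 !mxE.
  rewrite (bigD1 k)//= big1 => [|l nlk]; last first.
    by rewrite E eq_sym (negPf nlk) expr0n mulr0.
  rewrite -(sqn_orthogonal _ U1) /sqn E eqxx expr1n mulr1 addr0 (bigD1 k)//= big1.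
    by rewrite E eqxx expr1n addr0 mulr1.
  by move=> l nlk; rewrite E eq_sym (negPf nlk) expr0n.
have U2 k l : `|U k l| <= 1.
  have /matrixP/(_ k k) := U1; rewrite !mxE eqxx (bigD1 l)//= mxE => E.
  rewrite -(@ler_pXn2r _ 2)// ?nnegrE// expr1n -normrX ger0_norm ?sqr_ge0//.
  rewrite [leRHS](_ : 1 = true%:R)// -E expr2 lerDl.
  by apply: sumr_ge0 => m _; rewrite mxE -expr2 sqr_ge0.
rewrite mxE_spectral_sum; apply: (le_trans (ler_norm_sum _ _ _)).
rewrite (_ : n%:R * expR c = \sum_(k < n) expR c); last first.
  by rewrite sumr_const card_ord mulr_natl.
apply: ler_sum => k _; rewrite mxE normrM ger0_norm ?expR_ge0//.
rewrite -[leRHS]mulr1 ler_pM ?expR_ge0 ?ler_expR// normrM.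
by rewrite -[leRHS]mulr1 ler_pM.
Qed.
(** An arbitrarily chosen eigendecomposition gives no measurability in [A]. The power series does:
    its partial sums are polynomials in the entries. *)
Lemma cvg_expmx n (A : 'M[R]_n) i j : A^T = A ->
  (fun N => \sum_(0 <= k < N) k`!%:R^-1 * (A ^+ k) i j) @ \oo --> expmx A i j.
Proof.
move=> /expmx_spectral[U [a [U1 AE ->]]].
have AX k : A ^+ k = spectral_sum U (map_mx (fun x => x ^+ k) a).
  elim: k => [|k IH].
    rewrite expr0; transitivity (1%:M : 'M[R]_n) => //.
    rewrite -(spectral_sum_const1 U1); congr spectral_sum.
    by apply/rowP => l; rewrite !mxE.
  rewrite exprS IH; transitivity (A *m spectral_sum U (map_mx (fun x => x ^+ k) a)) => //.
  rewrite {1}AE spectral_sumM//; congr spectral_sum.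
  by apply/rowP => l; rewrite !mxE exprS.
have -> : (fun N => \sum_(0 <= k < N) k`!%:R^-1 * (A ^+ k) i j) =
    (fun N => \sum_l series (exp_coeff (a 0 l)) N * (U l i * U l j)).
  apply/funext => N; rewrite /series /=.
  under [RHS]eq_bigr do rewrite mulr_suml.
  rewrite exchange_big; apply: eq_bigr => k _.
  rewrite AX mxE_spectral_sum mulr_sumr; apply: eq_bigr => l _.
  by rewrite exp_coeffE mxE !mulrA.
rewrite mxE_spectral_sum; under [in X in _ --> X]eq_bigr do rewrite mxE.
apply: cvg_big => [|l _]; first exact: add_continuous.
apply: cvgM; [exact: is_cvg_series_exp_coeff|exact: cvg_cst].
Qed.

End matrix_exponential.

(** * Bounded measurable functions and laws of tuples *)

Section bounded_measurable.
Context (d : measure_display) (S : measurableType d) (R : realType).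
Implicit Types f g : S -> R.

(** This class is closed under ring operations and integrable for every probability, so means can be
    manipulated linearly without separate integrability arguments. *)
Definition bmf f := measurable_fun [set: S] f /\ exists M : R, forall x, `|f x| <= M.

Lemma bmf_cst (c : R) : bmf (fun=> c).
Proof. by split; [exact: measurable_cst|exists `|c|]. Qed.

Lemma bmfD f g : bmf f -> bmf g -> bmf (fun x => f x + g x).
Proof.
move=> [mf [M fM]] [mg [N gN]]; split; first exact: measurable_funD.
by exists (M + N) => x; rewrite (le_trans (ler_normD _ _))// lerD.
Qed.

Lemma bmfM f g : bmf f -> bmf g -> bmf (fun x => f x * g x).
Proof.
move=> [mf [M fM]] [mg [N gN]]; split; first exact: measurable_funM.
by exists (M * N) => x; rewrite normrM ler_pM.
Qed.

Lemma bmfN f : bmf f -> bmf (fun x => - f x).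
Proof.
move=> [mf [M fM]]; split; first exact: measurableT_comp.
by exists M => x; rewrite normrN.
Qed.

Lemma bmf_sum (I : Type) (s : seq I) (F : I -> S -> R) :
  (forall i, bmf (F i)) -> bmf (fun x => \sum_(i <- s) F i x).
Proof.
move=> bF; elim: s => [|i s IH].
  by under eq_fun do rewrite big_nil; exact: bmf_cst.
by under eq_fun do rewrite big_cons; exact: bmfD.
Qed.

Variable mu : probability S R.

Lemma bmf_integrable f : bmf f -> mu.-integrable setT (EFin \o f).
Proof.
move=> [mf [M fM]]; apply: measurable_bounded_integrable => //.
  by apply: (le_lt_trans (probability_le1 mu measurableT)); rewrite ltry.
exists M; split; first exact: num_real.
by move=> N MN x _ /=; rewrite (le_trans (fM x))// ltW.
Qed.

Lemma mean_cst (c : R) : (\int[mu]_x c) = c.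
Proof.
rewrite Rintegral_cst//.
transitivity (c * fine (1%E : \bar R)); last by rewrite mulr1.
by congr (_ * fine _); exact: probability_setT.
Qed.

Lemma meanD f g : bmf f -> bmf g ->
  \int[mu]_x (f x + g x) = \int[mu]_x f x + \int[mu]_x g x.
Proof. by move=> bf bg; rewrite RintegralD//; exact: bmf_integrable. Qed.

Lemma meanZ (c : R) f : bmf f -> \int[mu]_x (c * f x) = c * \int[mu]_x f x.
Proof. by move=> bf; rewrite RintegralZl//; exact: bmf_integrable. Qed.

Lemma meanN f : bmf f -> \int[mu]_x (- f x) = - \int[mu]_x f x.
Proof.
move=> bf; under eq_Rintegral do rewrite -mulN1r.
by rewrite meanZ// mulN1r.
Qed.

Lemma meanB f g : bmf f -> bmf g ->
  \int[mu]_x (f x - g x) = \int[mu]_x f x - \int[mu]_x g x.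
Proof. by move=> bf bg; rewrite meanD ?meanN//; exact: bmfN. Qed.

Lemma le_mean f g : bmf f -> bmf g -> (forall x, f x <= g x) ->
  \int[mu]_x f x <= \int[mu]_x g x.
Proof. by move=> bf bg fg; apply: le_Rintegral => //; exact: bmf_integrable. Qed.

Lemma mean_sum (I : Type) (s : seq I) (F : I -> S -> R) :
  (forall i, bmf (F i)) ->
  \int[mu]_x (\sum_(i <- s) F i x) = \sum_(i <- s) \int[mu]_x F i x.
Proof.
move=> bF; elim: s => [|i s IH].
  under eq_Rintegral do rewrite big_nil.
  by rewrite big_nil mean_cst.
under eq_Rintegral do rewrite big_cons.
by rewrite big_cons meanD// ?IH//; exact: bmf_sum.
Qed.

End bounded_measurable.

Lemma bmf_comp (d d' : measure_display) (S : measurableType d) (T : measurableType d')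
    (R : realType) (f : T -> R) (h : S -> T) :
  measurable_fun setT h -> bmf f -> bmf (f \o h).
Proof.
move=> mh [mf [M fM]]; split; first exact: measurableT_comp.
by exists M => x; exact: fM.
Qed.

Section tuple_laws.
Context (d : measure_display) (T : measurableType d) (R : realType) (n : nat).

Definition box (A : 'I_n -> set T) : set (n.-tuple T) :=
  [set t | forall i, A i (tnth t i)].

(** Boxes are stable under intersection, contain the whole space and generate the product
    sigma-algebra. *)
Lemma tuple_measure_unique (m1 m2 : {measure set (n.-tuple T) -> \bar R}) :
  (m1 setT < +oo)%E ->
  (forall A, (forall i, measurable (A i)) -> m1 (box A) = m2 (box A)) ->
  forall B, measurable B -> m1 B = m2 B.
Proof.
move=> m1oo m12.
pose G := [set B | exists2 A : 'I_n -> set T, (forall i, measurable (A i)) & B = box A].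
have GT : G setT by exists (fun=> setT) => //; apply/seteqP; split.
apply: (measure_unique G (fun=> setT)) => //.
- apply/seteqP; split.
    apply: smallest_sub; first exact: smallest_sigma_algebra.
    rewrite -bigcup_seq => B [i _ [A mA <-]]; apply: sub_sigma_algebra.
    (* A cylinder over coordinate [i] is the box with all other sides full. *)
    exists (fun j => if j == i then A else setT) => [j|]; first by case: ifP.
    apply/seteqP; split => t /=.
      by move=> [_ At] j; case: eqP => // ->.
    by move=> /(_ i); rewrite eqxx.
  apply: smallest_sub; first exact: sigma_algebra_measurable.
  move=> _ [A mA ->].
  have -> : box A = \bigcap_(i in [set: 'I_n]) ((@tnth n T)^~ i @^-1` A i).
    by apply/seteqP; split => t /= h i; [move=> _|]; exact: h.
  apply: fin_bigcap_measurable; first exact: finite_finset.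
  by move=> i _; rewrite -[X in measurable X]setTI; exact: measurable_tnth.
- move=> _ _ [A mA ->] [A' mA' ->]; exists (fun i => A i `&` A' i).
    by move=> i; exact: measurableI.
  apply/seteqP; split => t /=; first by move=> [h h'] i.
  by move=> h; split => i; have [] := h i.
- by apply/seteqP; split => // t _; exists 0%N.
- by move=> _ [A mA ->]; exact: m12.
Qed.

End tuple_laws.

Section exchangeability.
Context (d d' : measure_display) (S : measurableType d) (T : measurableType d')
  (R : realType) (Q : probability S R) (n : nat).

Lemma mean_eq_law (W W' : S -> n.-tuple T) (f : n.-tuple T -> R) :
  measurable_fun setT W -> measurable_fun setT W' -> bmf f ->
  (forall A, (forall i, measurable (A i)) -> Q (W @^-1` box A) = Q (W' @^-1` box A)) ->
  \int[Q]_s f (W s) = \int[Q]_s f (W' s).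
Proof.
move=> mW mW' bf WW'.
have mEf : measurable_fun setT (EFin \o f) by apply/measurable_EFinP; exact: bf.1.
rewrite /Rintegral; congr fine.
have <- := @integral_pushforward _ _ _ _ _ _ mW Q setT _ mEf (bmf_integrable Q (bmf_comp mW bf)) measurableT.
have <- := @integral_pushforward _ _ _ _ _ _ mW' Q setT _ mEf (bmf_integrable Q (bmf_comp mW' bf)) measurableT.
apply: eq_measure_integral => B mB _.
apply: tuple_measure_unique mB => //.
by rewrite /= /pushforward preimage_setT (le_lt_trans (probability_le1 Q measurableT))// ltry.
Qed.

End exchangeability.

(** * Exchangeable pairs *)

Section bounded_measurable_matrix.
Context (d : measure_display) (S : measurableType d) (R : realType).

Definition bmfmx n p (F : S -> 'M[R]_(n, p)) := forall i j, bmf (fun s => F s i j).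

Lemma bmfmx_cst n p (A : 'M[R]_(n, p)) : bmfmx (fun=> A).
Proof. by move=> i j; exact: bmf_cst. Qed.

Lemma bmfmxD n p (F G : S -> 'M[R]_(n, p)) :
  bmfmx F -> bmfmx G -> bmfmx (fun s => F s + G s).
Proof. by move=> bF bG i j; under eq_fun do rewrite mxE; exact: bmfD. Qed.

Lemma bmfmxN n p (F : S -> 'M[R]_(n, p)) : bmfmx F -> bmfmx (fun s => - F s).
Proof. by move=> bF i j; under eq_fun do rewrite mxE; exact: bmfN. Qed.

Lemma bmfmxZ n p c (F : S -> 'M[R]_(n, p)) : bmfmx F -> bmfmx (fun s => c *: F s).
Proof.
by move=> bF i j; under eq_fun do rewrite mxE; apply: bmfM => //; exact: bmf_cst.
Qed.

Lemma bmfmxM n p q (F : S -> 'M[R]_(n, p)) (G : S -> 'M[R]_(p, q)) :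
  bmfmx F -> bmfmx G -> bmfmx (fun s => F s *m G s).
Proof.
move=> bF bG i j; under eq_fun do rewrite mxE.
by apply: bmf_sum => k; exact: bmfM.
Qed.

Lemma bmfmx_sum n p (I : Type) (r : seq I) (F : I -> S -> 'M[R]_(n, p)) :
  (forall i, bmfmx (F i)) -> bmfmx (fun s => \sum_(i <- r) F i s).
Proof.
move=> bF i j; under eq_fun do rewrite summxE.
by apply: bmf_sum => k; exact: bF.
Qed.

Lemma bmf_mxtrace n (F : S -> 'M[R]_n) : bmfmx F -> bmf (fun s => \tr (F s)).
Proof. by move=> bF; apply: bmf_sum => i; exact: bF. Qed.

(** Measurability comes from the power series, boundedness from the uniform upper bound [c] on the
    eigenvalues. *)
Lemma bmfmx_expmx n (F : S -> 'M[R]_n) c : bmfmx F -> (forall s, (F s)^T = F s) ->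
  (forall s (u : 'rV[R]_n), (u *m F s *m u^T) 0 0 <= c * sqn u) ->
  bmfmx (fun s => expmx (F s)).
Proof.
move=> bF symF Fc i j; split; last first.
  by exists (n%:R * expR c) => s; exact: expmx_entry_le.
apply: (@measurable_fun_cvg _ _ _ _
  (fun N s => \sum_(0 <= k < N) k`!%:R^-1 * (F s ^+ k) i j)); last first.
  by move=> s _; exact: cvg_expmx.
move=> N; apply: measurable_sum => k; apply: measurable_funM => //.
have bX : bmfmx (fun s => F s ^+ k).
  elim: k => [|k IH]; first exact: bmfmx_cst.
  by under eq_fun do rewrite exprS; exact: bmfmxM.
exact: (bX i j).1.
Qed.

End bounded_measurable_matrix.

(** Here [A] and [B] will be the centred sum before and after exchanging one sample, and [Y], [Y']
    the two exchanged summands. *)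
Lemma mxtrace_trapezoid_scaled (R : realType) n (c : R) (A B Y Y' : 'M[R]_n) :
  0 < c -> A^T = A -> B^T = B -> A - B = Y - Y' ->
  2 * (\tr (Y *m expmx (c *: A)) - \tr (Y' *m expmx (c *: A))
       - \tr (Y *m expmx (c *: B)) + \tr (Y' *m expmx (c *: B))) <=
  c * (\tr ((Y - Y') *m (Y - Y') *m expmx (c *: A)) +
       \tr ((Y - Y') *m (Y - Y') *m expmx (c *: B))).
Proof.
move=> c0 symA symB AB.
have : 2 * \tr ((c *: A - c *: B) *m (expmx (c *: A) - expmx (c *: B))) <=
    \tr ((c *: A - c *: B) *m (c *: A - c *: B) *m (expmx (c *: A) + expmx (c *: B))).
  by apply: mxtrace_trapezoid; rewrite linearZ /= ?symA ?symB.
rewrite -scalerBr AB; move: (expmx _) (expmx _) => M N.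
rewrite -mulmxA -!scalemxAl -scalemxAr !mxtraceZ mulrCA ler_pM2l// mulmxA.
rewrite [in leRHS]mulmxDr [in leRHS]mxtraceD => h; apply: le_trans h; rewrite le_eqVlt; apply/orP; left.
apply/eqP; congr (2 * _).
have trB (P Q : 'M[R]_n) : \tr (P - Q) = \tr P - \tr Q by exact: raddfB.
by rewrite mulmxBl !mulmxBr !trB; ring.
Qed.

Section mean_combinations.
Context (d : measure_display) (S : measurableType d) (R : realType).
Variables (nu : probability S R) (f1 f2 f3 f4 f5 f6 : S -> R) (c : R).
Hypotheses (b1 : bmf f1) (b2 : bmf f2) (b3 : bmf f3) (b4 : bmf f4)
  (b5 : bmf f5) (b6 : bmf f6).

(** The functions [f1] to [f4] are the terms of the expanded trapezoid inequality: [f2] and [f3]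
    average to zero by independence, while [f4] and [f6] match [f1] and [f5] by exchange
    symmetry. *)
Lemma mean_le_combination1 :
  (forall t, 2 * (f1 t - f2 t - f3 t + f4 t) <= c * (f5 t + f6 t)) ->
  \int[nu]_t f2 t = 0 -> \int[nu]_t f3 t = 0 ->
  \int[nu]_t f4 t = \int[nu]_t f1 t -> \int[nu]_t f6 t = \int[nu]_t f5 t ->
  2 * \int[nu]_t f1 t <= c * \int[nu]_t f5 t.
Proof.
move=> key e2 e3 e4 e6.
have b12 := bmfD b1 (bmfN b2); have b123 := bmfD b12 (bmfN b3).
have := le_mean nu (bmfM (bmf_cst _ 2) (bmfD b123 b4)) (bmfM (bmf_cst _ c) (bmfD b5 b6)) key.
rewrite (meanZ nu 2 (bmfD b123 b4)) (meanZ nu c (bmfD b5 b6)).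
rewrite (meanD nu b123 b4) (meanB nu b12 b3) (meanB nu b1 b2) (meanD nu b5 b6).
by rewrite e2 e3 e4 e6; lra.
Qed.

(** The cross terms [f4] and [f5] both have the mean of [f3], which is nonnegative, and are
    discarded. *)
Lemma mean_le_combination2 :
  (forall t, f1 t <= c * f2 t + c * f3 t - f4 t - f5 t) -> (forall t, 0 <= f3 t) ->
  \int[nu]_t f2 t = \int[nu]_t f6 t -> \int[nu]_t f4 t = \int[nu]_t f3 t ->
  \int[nu]_t f5 t = \int[nu]_t f3 t ->
  \int[nu]_t f1 t <= c * (\int[nu]_t f6 t + \int[nu]_t f3 t).
Proof.
move=> key f30 e2 e4 e5; have p3 : 0 <= \int[nu]_t f3 t by exact: Rintegral_ge0.
have c2 := bmfM (bmf_cst _ c) b2; have c3 := bmfM (bmf_cst _ c) b3.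
have c23 := bmfD c2 c3; have c234 := bmfD c23 (bmfN b4).
have := le_mean nu b1 (bmfD c234 (bmfN b5)) key.
rewrite (meanB nu c234 b5) (meanB nu c23 b4) (meanD nu c2 c3) (meanZ nu c b2) (meanZ nu c b3).
by rewrite e2 e4 e5; lra.
Qed.

End mean_combinations.

(* Euler steps replace differentiation under the expectation; the factor 2 absorbs
   the discretisation error. *)
Lemma discrete_gronwall (R : realType) (u : nat -> R) (v h C : R) (N : nat) :
  0 <= v -> (forall j, 0 <= u j) -> u 0%N <= C ->
  (forall j, u j.+1 * (1 - h ^+ 2 * j.+1%:R * v) <= u j) ->
  let w := (h * N%:R) ^+ 2 * v in w * (2 + w) <= N%:R -> (0 < N)%N ->
  u N <= 2 * C * expR (w / 2).
Proof.
move=> v0 u0 uC ustep w wN N0.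
have N0' : 0 < N%:R :> R by rewrite ltr0n.
have w0 : 0 <= w by rewrite mulr_ge0// sqr_ge0.
have wltN : w < N%:R by nra.
have hw : h ^+ 2 * v = w / N%:R ^+ 2 by rewrite /w; field; rewrite gt_eqF.
pose r := N%:R - w; have r0 : 0 < r by rewrite subr_gt0.
have C0 : 0 <= C by apply: le_trans uC.
(* Step [i] has [x = w i / N^2 <= w / N], hence [x / (1 - x) <= (w / N) i / r]; [f j] is the sum of
   these bounds for [i] up to [j]. *)
pose f (j : nat) : R := w / N%:R * (j%:R * (j%:R + 1) / 2) / r.
have bound j : (j <= N)%N -> u j <= C * expR (f j).
  elim: j => [_|j IH jN].
    by rewrite /f mul0r mul0r mulr0 mul0r expR0 mulr1.
  pose x := h ^+ 2 * j.+1%:R * v.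
  have xE : x = w / N%:R ^+ 2 * j.+1%:R by rewrite /x mulrAC hw.
  have xw : x <= w / N%:R.
    rewrite xE expr2 invfM mulrA -mulrA ler_piMr ?divr_ge0 ?(ltW N0')//.
    by rewrite mulrC ler_pdivrMr// mul1r ler_nat.
  have wN1 : w / N%:R < 1 by rewrite ltr_pdivrMr// mul1r.
  have x1 : 0 < 1 - x by rewrite subr_gt0 (le_lt_trans xw).
  have := ustep j; rewrite -/x -ler_pdivlMr// => h1.
  apply: (le_trans h1).
  have x0 : 0 <= x by rewrite xE mulr_ge0 ?divr_ge0 ?sqr_ge0.
  (* [1 / (1 - x)] equals [1 + x / (1 - x)]. *)
  have inv_le : (1 - x)^-1 <= expR (x / (1 - x)).
    by apply: le_trans (expR_ge1Dx _); rewrite le_eqVlt; apply/orP; left; apply/eqP;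
       field; rewrite gt_eqF.
  have fS : f j.+1 = f j + w / N%:R * j.+1%:R / r.
    by rewrite /f -natr1; field; rewrite !gt_eqF.
  rewrite fS expRD mulrA ler_pM ?invr_ge0 ?(ltW x1) ?u0 ?IH ?(ltnW jN)//.
  apply: (le_trans inv_le); rewrite ler_expR.
  apply: (@le_trans _ _ (x / (1 - w / N%:R))).
    by apply: ler_wpM2l => //; rewrite lef_pV2 ?posrE ?subr_gt0 ?(le_lt_trans xw)// lerD2l lerN2.
  rewrite xE /r le_eqVlt; apply/orP; left; apply/eqP; field.
  by rewrite !gt_eqF// subr_gt0.
apply: (le_trans (bound N (leqnn N))).
(* After clearing denominators this is exactly [w (2 + w) <= N]. *)
have fN : f N <= 1 / 2 + w / 2.
  rewrite /f (_ : _ / r = w * (N%:R + 1) / (2 * r)); last by field; rewrite !gt_eqF.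
  by rewrite ler_pdivrMr ?mulr_gt0// /r; nra.
apply: (@le_trans _ _ (C * expR (1 / 2 + w / 2))).
  by rewrite ler_wpM2l// ler_expR.
rewrite expRD; have := expR_ge1Dx (- (1 / 2) : R); rewrite expRN.
have := expR_gt0 (1 / 2 : R); move: (expR (1 / 2)) (expR_gt0 (w / 2)) => e W e0 e1.
(* The excess [1/2] in the exponent costs [exp (1/2) <= 2], because [exp (-1/2) >= 1/2]. *)
have e2 : e <= 2.
  by move: e1; rewrite -(ler_pM2l e0) divff ?gt_eqF//; lra.
have := ler_wpM2r (mulr_ge0 C0 (ltW W)) e2; lra.
Qed.

(** * Trace moment generating function of the centred sum *)

Section trace_mgf.
Context (d d' : measure_display) (T : measurableType d) (R : realType) (L K : nat).
Variables (mu : probability T R) (nu : probability (L.+1.-tuple T) R).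
Variables (g : T -> 'rV[R]_K) (m : R).
Local Notation V := (L.+1.-tuple T).

Definition permute_tuple n (s : 'S_n) (t : n.-tuple T) : n.-tuple T :=
  [tuple tnth t (s i) | i < n].
Definition all_but_last n (t : n.+1.-tuple T) : n.-tuple T :=
  [tuple tnth t (lift ord_max l) | l < n].

(* [nu] plays the law of an i.i.d. sample of size [L] followed by an independent copy. *)
Hypothesis nu_sym : forall (s : 'S_L.+1) (f : V -> R), bmf f ->
  \int[nu]_t f (permute_tuple s t) = \int[nu]_t f t.
Hypothesis nu_last : forall (a : T -> R) (f : L.-tuple T -> R), bmf a -> bmf f ->
  \int[nu]_t (a (tnth t ord_max) * f (all_but_last t)) =
  (\int[mu]_x a x) * \int[nu]_t f (all_but_last t).
Hypothesis mg : forall k, measurable_fun setT (fun x => g x 0 k).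
Hypothesis gm : forall x, sqn (g x) <= m.
Hypothesis g_id : forall i j, \int[mu]_x (g x 0 i * g x 0 j) = (i == j)%:R.

Definition outer (x : T) : 'M[R]_K := (g x)^T *m g x.

Definition deviation (t : L.-tuple T) : 'M[R]_K :=
  \sum_(l < L) (1%:M - outer (tnth t l)).

Lemma tr_outer x : (outer x)^T = outer x.
Proof. by rewrite trmx_mul trmxK. Qed.

Lemma outer_sqr x : outer x *m outer x = sqn (g x) *: outer x.
Proof.
rewrite /outer mulmxA -[_ *m g x *m (g x)^T]mulmxA sqnE mul_mx_scalar.
by rewrite -scalemxAl.
Qed.

Lemma tr_deviation t : (deviation t)^T = deviation t.
Proof.
rewrite /deviation linear_sum /=; apply: eq_bigr => l _.
by rewrite linearB /= trmx1 tr_outer.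
Qed.

Lemma outer_form x (u : 'rV[R]_K) : (u *m outer x *m u^T) 0 0 = ((g x *m u^T) 0 0) ^+ 2.
Proof.
rewrite /outer !mulmxA; have -> : u *m (g x)^T = (g x *m u^T)^T.
  by rewrite trmx_mul trmxK.
rewrite -mulmxA; move: (g x *m u^T) => w.
by rewrite mxE big_ord_recl big_ord0 addr0 mxE expr2.
Qed.

Lemma outer_trace_ge0 x (A : 'M[R]_K) : A^T = A -> 0 <= \tr (outer x *m expmx A).
Proof.
move=> symA; rewrite /outer -mulmxA mxtrace_mulC.
rewrite trace_mx11; exact: expmx_form_ge0.
Qed.

(** Each [outer] is positive semidefinite, so each centred summand is at most the identity. This
    one-sided bound suffices to bound the exponential for nonnegative scalings. *)
Lemma deviation_form_le t (u : 'rV[R]_K) :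
  (u *m deviation t *m u^T) 0 0 <= L%:R * sqn u.
Proof.
rewrite /deviation mulmx_sumr mulmx_suml summxE.
rewrite (_ : L%:R * _ = \sum_(l < L) sqn u); last first.
  by rewrite sumr_const card_ord mulr_natl.
apply: ler_sum => l _; rewrite mulmxBr mulmxBl mulmx1 [leLHS]mxE [X in _ + X]mxE.
by rewrite sqnE outer_form mxE mulr1n lerBlDr lerDl sqr_ge0.
Qed.

Lemma m_ge0 : 0 <= m.
Proof. by apply: le_trans (gm point); exact: sqn_ge0. Qed.

Lemma bmfmx_outer : bmfmx outer.
Proof.
have bg : bmfmx g.
  (* [|z| <= (z^2 + 1) / 2] bounds a coordinate by [m + 1] without a square root. *)
  move=> i j; rewrite ord1; split=> //; exists (m + 1) => x.
  have gj : g x 0 j ^+ 2 <= m.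
    by apply: le_trans (gm x); rewrite /sqn (bigD1 j)//= lerDl sumr_ge0// => k _;
      exact: sqr_ge0.
  rewrite ler_norml; have := sqr_ge0 (g x 0 j + 1); have := sqr_ge0 (g x 0 j - 1).
  have := m_ge0; move=> *; apply/andP; split; nra.
by apply: bmfmxM => // i j; under eq_fun do rewrite mxE; exact: bg.
Qed.

Lemma bmfmx_deviation : bmfmx deviation.
Proof.
apply: bmfmx_sum => l; apply: bmfmxD; first exact: bmfmx_cst.
apply: bmfmxN => i j; apply: (bmf_comp (h := fun t => tnth t l) (f := fun x => outer x i j)).
  exact: measurable_tnth.
exact: bmfmx_outer.
Qed.

Lemma tr_scaled_deviation t c : (c *: deviation t)^T = c *: deviation t.
Proof. by rewrite linearZ /= tr_deviation. Qed.

Lemma bmfmx_expmx_deviation c : 0 <= c -> bmfmx (fun t => expmx (c *: deviation t)).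
Proof.
move=> c0; apply: (@bmfmx_expmx _ _ _ _ _ (c * L%:R)).
- by apply: bmfmxZ; exact: bmfmx_deviation.
- by move=> t; exact: tr_scaled_deviation.
- move=> t u; rewrite -scalemxAr -scalemxAl mxE -mulrA.
  by rewrite ler_wpM2l// deviation_form_le.
Qed.

Lemma bmfmx_comp d1 d2 (S1 : measurableType d1) (S2 : measurableType d2) n p
    (h : S1 -> S2) (F : S2 -> 'M[R]_(n, p)) :
  measurable_fun setT h -> bmfmx F -> bmfmx (F \o h).
Proof. by move=> mh bF i j; apply: (bmf_comp (f := fun x => F x i j)). Qed.

Lemma measurable_permute n (s : 'S_n) : measurable_fun setT (@permute_tuple n s).
Proof.
apply/measurable_fun_tnthP => i; rewrite /comp /=.
by under eq_fun do rewrite tnth_mktuple; exact: measurable_tnth.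
Qed.

Lemma measurable_all_but_last n : measurable_fun setT (@all_but_last n).
Proof.
apply/measurable_fun_tnthP => i; rewrite /comp /=.
by under eq_fun do rewrite tnth_mktuple; exact: measurable_tnth.
Qed.

Lemma mean_outer i j : \int[mu]_x outer x i j = (i == j)%:R.
Proof.
rewrite -g_id; apply: eq_Rintegral => x _.
by rewrite !mxE big_ord_recl big_ord0 addr0 mxE.
Qed.

Local Notation last t := (tnth t ord_max).
Local Notation init t := (all_but_last t).

(** The last entry is independent of the others and its [outer] has mean the identity, so it can be
    averaged out inside the trace. *)
Lemma mean_outer_last (C : L.-tuple T -> 'M[R]_K) : bmfmx C ->
  \int[nu]_t \tr (outer (last t) *m C (init t)) = \int[nu]_t \tr (C (init t)).
Proof.
move=> bC; have bCi : bmfmx (fun t : V => C (init t)).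
  by apply: (bmfmx_comp (F := C)) => //; exact: measurable_all_but_last.
have bO : bmfmx (fun t : V => outer (last t)).
  by apply: (bmfmx_comp (F := outer)); [exact: measurable_tnth|exact: bmfmx_outer].
have nuO i j : \int[nu]_t (outer (last t) i j * C (init t) j i) =
    (i == j)%:R * \int[nu]_t C (init t) j i.
  rewrite (nu_last (a := fun x => outer x i j) (f := fun t => C t j i)) ?mean_outer//.
  exact: bmfmx_outer.
rewrite !mean_sum//; last by move=> i; exact: bmfmxM.
apply: eq_bigr => i _; under eq_Rintegral do rewrite mxE.
rewrite mean_sum; last by move=> j; exact: bmfM.
under eq_bigr do rewrite nuO.
rewrite (bigD1 i)//= big1 => [|j nji]; first by rewrite eqxx mul1r addr0.
by rewrite eq_sym (negPf nji) mul0r.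
Qed.

Section one_exchange.
Variables (c : R) (k : 'I_L).
Hypothesis c_gt0 : 0 < c.

(** [o] is the place of sample [k] in the extended tuple, and [sw] exchanges that sample with the
    independent copy. [F] depends only on the first [L] entries. *)
Let o := lift ord_max k.
Let s := tperm o ord_max.
Let sw (t : V) := permute_tuple s t.
Let F (t : V) := expmx (c *: deviation (init t)).
Let Z (t : V) := outer (tnth t o).
Let Z' (t : V) := outer (last t).

Let bF : bmfmx F.
Proof.
apply: (bmfmx_comp (F := fun t => expmx (c *: deviation t))).
  exact: measurable_all_but_last.
by apply: bmfmx_expmx_deviation; exact: ltW.
Qed.

Let bZ : bmfmx Z.
Proof. by apply: (bmfmx_comp (F := outer)); [exact: measurable_tnth|exact: bmfmx_outer]. Qed.

Let bZ' : bmfmx Z'.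
Proof. by apply: (bmfmx_comp (F := outer)); [exact: measurable_tnth|exact: bmfmx_outer]. Qed.

Let bFs : bmfmx (fun t => F (sw t)).
Proof. by apply: (bmfmx_comp (F := F)) => //; exact: measurable_permute. Qed.

Let Zs t : Z (sw t) = Z' t.
Proof. by rewrite /Z /Z' /sw tnth_mktuple tpermL. Qed.

Let Z's t : Z' (sw t) = Z t.
Proof. by rewrite /Z /Z' /sw tnth_mktuple tpermR. Qed.

Let deviation_sw t :
  deviation (init t) - deviation (init (sw t)) = Z' t - Z t.
Proof.
rewrite /deviation -sumrB (bigD1 k)//= big1 => [|l nlk].
  by rewrite !tnth_mktuple tpermL addr0 opprB addrC addrA subrK.
rewrite !tnth_mktuple tpermD ?subrr//; last by rewrite neq_lift.
by rewrite (inj_eq lift_inj) eq_sym.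
Qed.

Let mean_sw f : bmf f -> \int[nu]_t f (sw t) = \int[nu]_t f t.
Proof. exact: nu_sym. Qed.

Let mean_last_F : \int[nu]_t \tr ((1%:M - Z' t) *m F t) = 0.
Proof.
under eq_Rintegral do rewrite mulmxBl mul1mx raddfB /=.
rewrite (meanB nu (bmf_mxtrace bF) (bmf_mxtrace (bmfmxM bZ' bF))).
rewrite (mean_outer_last (C := fun t => expmx (c *: deviation t))) ?subrr//.
by apply: bmfmx_expmx_deviation; exact: ltW.
Qed.

Let bYF (G H : V -> 'M[R]_K) : bmfmx G -> bmfmx H -> bmf (fun t => \tr ((1%:M - G t) *m H t)).
Proof.
move=> bG bH; apply: bmf_mxtrace; apply: bmfmxM => //.
by apply: bmfmxD; [exact: bmfmx_cst|exact: bmfmxN].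
Qed.

Let bDF (H : V -> 'M[R]_K) : bmfmx H ->
  bmf (fun t => \tr ((Z' t - Z t) *m (Z' t - Z t) *m H t)).
Proof.
move=> bH; apply: bmf_mxtrace; apply: bmfmxM => //.
by apply: bmfmxM; apply: bmfmxD => //; exact: bmfmxN.
Qed.

Let exchange_le :
  2 * \int[nu]_t \tr ((1%:M - Z t) *m F t) <=
  c * \int[nu]_t \tr ((Z' t - Z t) *m (Z' t - Z t) *m F t).
Proof.
(* After the swap, the summand is independent of the exponential and centred. *)
have E1 : \int[nu]_t \tr ((1%:M - Z t) *m F (sw t)) = 0.
  rewrite -mean_last_F; apply: etrans (mean_sw (bYF bZ' bF)).
  by apply: eq_Rintegral => t _; rewrite Z's.
have E2 : \int[nu]_t \tr ((1%:M - Z' t) *m F (sw t)) =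
    \int[nu]_t \tr ((1%:M - Z t) *m F t).
  apply: etrans (mean_sw (bYF bZ bF)).
  by apply: eq_Rintegral => t _; rewrite Zs.
have E3 : \int[nu]_t \tr ((Z' t - Z t) *m (Z' t - Z t) *m F (sw t)) =
    \int[nu]_t \tr ((Z' t - Z t) *m (Z' t - Z t) *m F t).
  apply: etrans (mean_sw (bDF bF)); apply: eq_Rintegral => t _.
  by rewrite Z's Zs -[Z t - Z' t]opprB mulNmx mulmxN opprK.
have key t : 2 * (\tr ((1%:M - Z t) *m F t) - \tr ((1%:M - Z' t) *m F t)
      - \tr ((1%:M - Z t) *m F (sw t)) + \tr ((1%:M - Z' t) *m F (sw t))) <=
    c * (\tr ((Z' t - Z t) *m (Z' t - Z t) *m F t) +
     \tr ((Z' t - Z t) *m (Z' t - Z t) *m F (sw t))).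
  have ZE : Z' t - Z t = (1%:M - Z t) - (1%:M - Z' t).
    by rewrite [RHS]addrC opprB addrA subrK.
  have DE := etrans (deviation_sw t) ZE; rewrite ZE.
  exact: (mxtrace_trapezoid_scaled c_gt0 (tr_deviation _) (tr_deviation _) DE).
have b1 := bYF bZ bF; have b2 := bYF bZ' bF; have b3 := bYF bZ bFs.
have b4 := bYF bZ' bFs; have b5 := bDF bF; have b6 := bDF bFs.
exact: (mean_le_combination1 b1 b2 b3 b4 b5 b6 key mean_last_F E1 E2 E3).
Qed.

(** Rank one gives [Z^2 = |g|^2 Z], with [|g|^2 <= m], under the trace against a positive matrix.
    The cross terms are kept, since independence evaluates their means. *)
Let sqr_le t : \tr ((Z' t - Z t) *m (Z' t - Z t) *m F t) <=
  m * \tr (Z' t *m F t) + m * \tr (Z t *m F t)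
  - \tr (Z' t *m (Z t *m F t)) - \tr (Z' t *m (F t *m Z t)).
Proof.
have := outer_trace_ge0 (last t) (tr_scaled_deviation (init t) c).
have := outer_trace_ge0 (tnth t o) (tr_scaled_deviation (init t) c).
have := outer_sqr (last t); have := outer_sqr (tnth t o).
have := gm (last t); have := gm (tnth t o).
rewrite -/(F t) -/(Z t) -/(Z' t).
move: (sqn _) (sqn _) (F t) (Z t) (Z' t) => a b M A B am bm AA BB A0 B0.
have trB (P Q : 'M[R]_K) : \tr (P - Q) = \tr P - \tr Q by exact: raddfB.
rewrite !(mulmxBl, mulmxBr) AA BB !trB -!scalemxAl !mxtraceZ.
rewrite -[B *m A *m M]mulmxA -[A *m B *m M]mulmxA [\tr (A *m (B *m M))]mxtrace_mulC.
rewrite -[B *m M *m A]mulmxA; nra.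
Qed.

(** Averaging out [Z'] turns its term into the mean of [\tr (F t)] and each cross term into the mean
    of [\tr (Z t *m F t)]; the latter enter negatively and are dropped. *)
Lemma exchange_bound : 2 * \int[nu]_t \tr ((1%:M - Z t) *m F t) <=
  c * (m * (\int[nu]_t \tr (F t) + \int[nu]_t \tr (Z t *m F t))).
Proof.
apply: (le_trans exchange_le); rewrite ler_pM2l//.
have bC : bmfmx (fun t : L.-tuple T => expmx (c *: deviation t)).
  by apply: bmfmx_expmx_deviation; exact: ltW.
have bO : bmfmx (fun t : L.-tuple T => outer (tnth t k)).
  by apply: (bmfmx_comp (F := outer)); [exact: measurable_tnth|exact: bmfmx_outer].
have E0 := mean_outer_last bC.
have ZE t : Z t = outer (tnth (init t) k) by rewrite tnth_mktuple.
have E1 : \int[nu]_t \tr (Z' t *m (Z t *m F t)) = \int[nu]_t \tr (Z t *m F t).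
  transitivity (\int[nu]_t \tr (outer (last t) *m (outer (tnth (init t) k) *m F t))).
    by apply: eq_Rintegral => t _; rewrite ZE.
  apply: etrans (mean_outer_last (bmfmxM bO bC)) _.
  by apply: eq_Rintegral => t _; rewrite ZE.
have E2 : \int[nu]_t \tr (Z' t *m (F t *m Z t)) = \int[nu]_t \tr (Z t *m F t).
  transitivity (\int[nu]_t \tr (outer (last t) *m (F t *m outer (tnth (init t) k)))).
    by apply: eq_Rintegral => t _; rewrite ZE.
  apply: etrans (mean_outer_last (bmfmxM bC bO)) _.
  by apply: eq_Rintegral => t _; rewrite ZE mxtrace_mulC.
have b0 : bmf (fun t => \tr (Z t *m F t)) by exact: bmf_mxtrace (bmfmxM bZ bF).
have b0' : bmf (fun t => \tr (Z' t *m F t)) by exact: bmf_mxtrace (bmfmxM bZ' bF).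
have b1 := bmf_mxtrace (bmfmxM bZ' (bmfmxM bZ bF)).
have b2 := bmf_mxtrace (bmfmxM bZ' (bmfmxM bF bZ)).
apply: (mean_le_combination2 (bDF bF) b0' b0 b1 b2 sqr_le _ E0 E1 E2) => t.
exact: (outer_trace_ge0 (tnth t o) (tr_scaled_deviation (init t) c)).
Qed.

End one_exchange.

Definition mgf (c : R) := \int[nu]_t \tr (expmx (c *: deviation (init t))).

Lemma bmfmx_expmx_init c : 0 <= c -> bmfmx (fun t : V => expmx (c *: deviation (init t))).
Proof.
move=> c0; apply: (bmfmx_comp (F := fun t => expmx (c *: deviation t))).
  exact: measurable_all_but_last.
exact: bmfmx_expmx_deviation.
Qed.

Lemma mgf_ge0 c : 0 <= mgf c.
Proof.
apply: Rintegral_ge0 => t _; apply: mxtrace_expmx_ge0; exact: tr_scaled_deviation.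
Qed.

Lemma mean_deviation_le c : 0 < c ->
  \int[nu]_t \tr (deviation (init t) *m expmx (c *: deviation (init t))) <=
  L%:R * (c * (m * mgf c)).
Proof.
move=> c0; have bF := bmfmx_expmx_init (ltW c0).
pose a k := \int[nu]_t \tr ((1%:M - outer (tnth t (lift ord_max k))) *m
   expmx (c *: deviation (init t))).
have bZ k : bmfmx (fun t : V => outer (tnth t (lift ord_max k))).
  by apply: (bmfmx_comp (F := outer)); [exact: measurable_tnth|exact: bmfmx_outer].
have bY k : bmf (fun t : V => \tr ((1%:M - outer (tnth t (lift ord_max k))) *m
   expmx (c *: deviation (init t)))).
  apply: bmf_mxtrace; apply: bmfmxM => //.
  by apply: bmfmxD; [exact: bmfmx_cst|exact: bmfmxN].
have -> : \int[nu]_t \tr (deviation (init t) *m expmx (c *: deviation (init t))) =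
    \sum_(k < L) a k.
  rewrite /a -mean_sum//; apply: eq_Rintegral => t _.
  rewrite -raddf_sum -mulmx_suml /=; congr (\tr (_ *m _)).
  by apply: eq_bigr => k _; rewrite tnth_mktuple.
rewrite (_ : L%:R * _ = \sum_(k < L) c * (m * mgf c)); last first.
  by rewrite sumr_const card_ord mulr_natl.
apply: ler_sum => k _; have := exchange_bound k c0; rewrite -/(a k) -/(mgf c).
have -> : \int[nu]_t \tr (outer (tnth t (lift ord_max k)) *m expmx (c *: deviation (init t))) =
    mgf c - a k.
  rewrite /mgf /a -(meanB nu (bmf_mxtrace bF) (bY k)).
  apply: eq_Rintegral => t _; rewrite mulmxBl mul1mx.
  by rewrite [\tr (_ - _)]raddfB opprB addrC subrK.
have : 0 <= c * (m * mgf c) by rewrite !mulr_ge0 ?m_ge0 ?mgf_ge0// ltW.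
have : 0 <= c * m by rewrite mulr_ge0 ?m_ge0// ltW.
move: (a k) (mgf c) => x M cm0 cmM0 h.
have [x0|x0] := leP x 0; first exact: le_trans x0 _.
have := mulr_ge0 cm0 (ltW x0); nra.
Qed.

(** A backward Euler step: Klein's inequality bounds the increment by the derivative at the endpoint
    [c + h], which is positive even when [c = 0]. *)
Lemma mgf_step c h : 0 <= c -> 0 < h ->
  mgf (c + h) * (1 - h * (c + h) * (m * L%:R)) <= mgf c.
Proof.
move=> c0 h0; have ch0 : 0 < c + h by rewrite ltr_wpDl.
have b1 := bmf_mxtrace (bmfmx_expmx_init (ltW ch0)).
have b2 := bmf_mxtrace (bmfmx_expmx_init c0).
have bS : bmfmx (fun t : V => deviation (init t)).
  by apply: (bmfmx_comp (F := deviation)); [exact: measurable_all_but_last|exact: bmfmx_deviation].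
have b3 := bmf_mxtrace (bmfmxM bS (bmfmx_expmx_init (ltW ch0))).
have key t : \tr (expmx ((c + h) *: deviation (init t))) - \tr (expmx (c *: deviation (init t)))
    <= h * \tr (deviation (init t) *m expmx ((c + h) *: deviation (init t))).
  have := klein_expmx (tr_scaled_deviation (init t) (c + h)) (tr_scaled_deviation (init t) c).
  rewrite (_ : _ - c *: _ = h *: deviation (init t)).
    by rewrite -scalemxAl mxtraceZ.
  by rewrite -scalerBl; congr (_ *: _); ring.
have := le_mean nu (bmfD b1 (bmfN b2)) (bmfM (bmf_cst _ h) b3) key.
rewrite (meanB nu b1 b2) (meanZ nu h b3) -/(mgf c) -/(mgf (c + h)).
have := mean_deviation_le ch0; rewrite -(ler_pM2l h0).
move: (\int[nu]_t _) => D h1 h2.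
apply: le_trans (_ : mgf (c + h) - h * (L%:R * ((c + h) * (m * mgf (c + h)))) <= _).
  by rewrite le_eqVlt; apply/orP; left; apply/eqP; ring.
by rewrite lerBlDr -lerBlDl (le_trans h2 h1).
Qed.

Lemma mgf0_le : mgf 0 <= K%:R.
Proof.
have E t : \tr (expmx (0 *: deviation (init t))) = K%:R.
  have sym0 : (0 *: deviation (init t))^T = 0 *: deviation (init t).
    exact: tr_scaled_deviation.
  have [U [a [U1 AE ->]]] := expmx_spectral sym0.
  (* The decomposition behind [expmx] is a choice, so every decomposition of the zero matrix must be
     shown to have zero spectrum. *)
  have a0 : a = 0.
    have : U *m spectral_sum U a *m U^T = diag_mx a.
      by rewrite /spectral_sum !mulmxA U1 mul1mx -mulmxA U1 mulmx1.
    rewrite -AE scale0r mulmx0 mul0mx => /matrixP h.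
    by apply/rowP => i; have := h i i; rewrite !mxE eqxx mulr1n => <-.
  rewrite (_ : map_mx _ _ = const_mx 1); last by apply/rowP => i; rewrite !mxE a0 mxE expR0.
  by rewrite spectral_sum_const1// mxtrace1.
by rewrite /mgf; under eq_Rintegral do rewrite E; rewrite mean_cst.
Qed.

Lemma mgf_bound c : 0 <= c -> mgf c <= 2 * K%:R * expR (c ^+ 2 * (m * L%:R) / 2).
Proof.
rewrite le_eqVlt => /predU1P[<-|c0].
  rewrite expr0n !mul0r expR0 mulr1; apply: (le_trans mgf0_le).
  by rewrite ler_peMl// ler1n.
have v0 : 0 <= m * L%:R by rewrite mulr_ge0 ?m_ge0.
pose w := c ^+ 2 * (m * L%:R).
have w0 : 0 <= w by rewrite mulr_ge0 ?sqr_ge0.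
(* Enough Euler steps of length [c / N] for the condition [w (2 + w) <= N] of
   [discrete_gronwall]. *)
pose N := (Num.bound (w * (2 + w))).+1.
have NN : w * (2 + w) <= N%:R.
  apply: ltW; apply: lt_le_trans (_ : (Num.bound (w * (2 + w)))%:R <= _); last by rewrite ler_nat.
  by apply: archi_boundP; rewrite mulr_ge0// addr_ge0.
have N0 : 0 < N%:R :> R by rewrite ltr0n.
pose h := c / N%:R; have h0 : 0 < h by rewrite divr_gt0.
have hN : h * N%:R = c by rewrite /h divfK ?gt_eqF.
have := @discrete_gronwall R (fun j => mgf (j%:R * h)) (m * L%:R) h K%:R N v0.
rewrite hN [N%:R * h]mulrC hN; apply => //.
- by move=> j; exact: mgf_ge0.
- by rewrite mul0r mgf0_le.
- move=> j; have := @mgf_step (j%:R * h) h; rewrite mulr_ge0 ?(ltW h0)// => /(_ isT h0).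
  rewrite -{2 4}[h]mul1r -!mulrDl natr1 => hs; apply: le_trans hs.
  by rewrite le_eqVlt; apply/orP; left; apply/eqP; ring.
Qed.

End trace_mgf.

(** * Independent samples *)

Lemma EFin_mean (d : measure_display) (S : measurableType d) (R : realType)
    (mu : probability S R) (f : S -> R) : bmf f ->
  (\int[mu]_x f x)%:E = (\int[mu]_x (f x)%:E)%E.
Proof.
move=> bf; rewrite /Rintegral fineK//.
exact: integrable_fin_num (bmf_integrable mu bf).
Qed.

Section product_mean.
Context (d d' : measure_display) (S : measurableType d) (T : measurableType d')
  (R : realType) (P : probability S R) (mu : probability T R).

Lemma mean_prod (b : S -> R) (a : T -> R) : bmf b -> bmf a ->
  \int[(P \x mu)%E]_z (b z.1 * a z.2) = \int[P]_x b x * \int[mu]_y a y.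
Proof.
move=> bb ba.
have bba : bmf (fun z : S * T => b z.1 * a z.2).
  by apply: bmfM; [exact: (bmf_comp (h := fst))|exact: (bmf_comp (h := snd))].
apply: EFin_inj; rewrite EFin_mean//.
rewrite -(integral12_prod_meas1 (bmf_integrable (P \x mu)%E bba)).
rewrite mulrC -meanZ// EFin_mean; last by apply: bmfM => //; exact: bmf_cst.
apply: eq_integral => x _; rewrite /fubini_F /= -EFin_mean; last first.
  by apply: bmfM => //; exact: bmf_cst.
by rewrite meanZ// mulrC.
Qed.

End product_mean.

Section iid.
Context (d d' : measure_display) (Omega : measurableType d) (T : measurableType d')
  (R : realType) (P : probability Omega R) (mu : probability T R) (L : nat)
  (X : 'I_L -> Omega -> T).
Hypothesis mX : forall l, measurable_fun setT (X l).
Hypothesis lawX : forall l A, measurable A -> P (X l @^-1` A) = mu A.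
Hypothesis indX : forall A : 'I_L -> set T, (forall l, measurable (A l)) ->
    P (\bigcap_(l in [set: 'I_L]) (X l @^-1` A l)) = (\prod_(l < L) P (X l @^-1` A l))%E.

Definition sample (w : Omega) : L.-tuple T := [tuple X l w | l < L].

Lemma measurable_sample : measurable_fun setT sample.
Proof.
apply/measurable_fun_tnthP => i; rewrite /comp /=.
by under eq_fun do rewrite tnth_mktuple; exact: mX.
Qed.

(** [Omega] may carry no further independent copy, so a factor [T] with law [mu] is adjoined and its
    coordinate is placed last. *)
Definition extended_sample (z : Omega * T) : L.+1.-tuple T :=
  [tuple if unlift ord_max i is Some l then X l z.1 else z.2 | i < L.+1].

Lemma measurable_extended_sample : measurable_fun setT extended_sample.
Proof.
apply/measurable_fun_tnthP => i; rewrite /comp /=.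
under eq_fun do rewrite tnth_mktuple.
case: (unlift ord_max i) => [l|]; last exact: measurable_snd.
by apply: measurableT_comp (mX l) _; exact: measurable_fst.
Qed.

Lemma last_extended_sample z : tnth (extended_sample z) ord_max = z.2.
Proof. by rewrite tnth_mktuple unlift_none. Qed.

Lemma init_extended_sample z : all_but_last (extended_sample z) = sample z.1.
Proof. by apply: eq_from_tnth => i; rewrite !tnth_mktuple liftK. Qed.

(** The box probabilities factor into identical marginals. This symmetric expression is the source
    of exchangeability. *)
Lemma extended_sample_box (A : 'I_L.+1 -> set T) : (forall i, measurable (A i)) ->
  (P \x mu)%E (extended_sample @^-1` box A) = (\prod_i mu (A i))%E.
Proof.
move=> mA; have -> : extended_sample @^-1` box A =
    (\bigcap_(l in [set: 'I_L]) (X l @^-1` A (lift ord_max l))) `*` A ord_max.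
  apply/seteqP; split => [z h|z [h1 h2] i] /=.
    split; last by have := h ord_max; rewrite last_extended_sample.
    by move=> l _; have := h (lift ord_max l); rewrite tnth_mktuple liftK.
  rewrite tnth_mktuple; case: unliftP => [l ->|->] //; exact: h1.
have mXA l B : measurable B -> measurable (X l @^-1` B).
  by move=> mB; rewrite -[X in measurable X]setTI; exact: mX.
have mcap : measurable (\bigcap_(l in [set: 'I_L]) (X l @^-1` A (lift ord_max l))).
  by apply: fin_bigcap_measurable; [exact: finite_finset|move=> l _; exact: mXA].
apply: etrans (product_measure1E P mu mcap (mA ord_max)) _.
rewrite (bigD1_ord ord_max)//= muleC; congr (_ * _)%E.
apply: etrans (indX (fun l => mA (lift ord_max l))) _.
by apply: eq_bigr => l _; exact: lawX.
Qed.

Definition extended_sample_mfun : {mfun (Omega * T)%type >-> L.+1.-tuple T} :=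
  HB.pack extended_sample (isMeasurableFun.Build _ _ _ _ _ measurable_extended_sample).

Definition extended_law : probability (L.+1.-tuple T) R :=
  distribution (P \x mu)%E extended_sample_mfun.

Lemma mean_extended_law (f : L.+1.-tuple T -> R) : bmf f ->
  \int[extended_law]_t f t = \int[(P \x mu)%E]_z f (extended_sample z).
Proof.
move=> bf; rewrite /Rintegral /extended_law integral_distribution//.
  by apply/measurable_EFinP; exact: bf.1.
exact: (bmf_integrable _ (bmf_comp measurable_extended_sample bf)).
Qed.

Lemma extended_law_sym (s : 'S_L.+1) (f : L.+1.-tuple T -> R) : bmf f ->
  \int[extended_law]_t f (permute_tuple s t) = \int[extended_law]_t f t.
Proof.
move=> bf; rewrite !mean_extended_law//; last first.
  by apply: bmf_comp => //; exact: measurable_permute.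
apply: (mean_eq_law (W := fun z => permute_tuple s (extended_sample z))) => //.
- by apply: measurableT_comp; [exact: measurable_permute|exact: measurable_extended_sample].
- exact: measurable_extended_sample.
- move=> A mA; apply: etrans (esym (extended_sample_box mA)).
  (* The permuted sample lies in a box exactly when the original one lies in the box with its sides
     permuted inversely. *)
  have -> : (fun z => permute_tuple s (extended_sample z)) @^-1` box A =
      extended_sample @^-1` box (fun i => A ((s^-1)%g i)).
    apply/seteqP; split => z /= h i.
      by have := h ((s^-1)%g i); rewrite [X in A _ X]tnth_mktuple permKV.
    by rewrite [X in A _ X]tnth_mktuple; have := h (s i); rewrite permK.
  apply: etrans (extended_sample_box (fun i => mA _)) _.
  by rewrite [RHS](reindex_inj (@perm_inj _ (s^-1)%g)).
Qed.

Lemma extended_law_last (a : T -> R) (f : L.-tuple T -> R) : bmf a -> bmf f ->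
  \int[extended_law]_t (a (tnth t ord_max) * f (all_but_last t)) =
  (\int[mu]_x a x) * \int[extended_law]_t f (all_but_last t).
Proof.
move=> ba bf; have bs : bmf (f \o sample) by apply: bmf_comp => //; exact: measurable_sample.
have bfi : bmf (fun t : L.+1.-tuple T => f (all_but_last t)).
  by apply: (bmf_comp (f := f)) => //; exact: measurable_all_but_last.
rewrite !mean_extended_law//; last first.
  by apply: bmfM => //; apply: (bmf_comp (f := a)) => //; exact: measurable_tnth.
under eq_Rintegral do rewrite last_extended_sample init_extended_sample mulrC.
rewrite (mean_prod P mu bs ba) mulrC; congr (_ * _).
under [RHS]eq_Rintegral do rewrite init_extended_sample -[f _]mulr1.
by rewrite (mean_prod P mu bs (bmf_cst _ 1)) mean_cst mulr1.
Qed.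

Variables (K : nat) (g : T -> 'rV[R]_K) (m : R).
Hypothesis mg : forall k, measurable_fun setT (fun x => g x 0 k).
Hypothesis gm : forall x, sqn (g x) <= m.
Hypothesis g_id : forall i j, \int[mu]_x (g x 0 i * g x 0 j) = (i == j)%:R.

Lemma sample_mgf_bound c : 0 <= c ->
  \int[P]_w \tr (expmx (c *: deviation g (sample w))) <=
  2 * K%:R * expR (c ^+ 2 * (m * L%:R) / 2).
Proof.
move=> c0; apply: le_trans (mgf_bound extended_law_sym extended_law_last mg gm g_id c0).
have bF := bmfmx_expmx_deviation L mg gm c0.
have bs : bmf (fun w => \tr (expmx (c *: deviation g (sample w)))).
  apply: (bmf_comp (f := fun t => \tr (expmx (c *: deviation g t)))).
    exact: measurable_sample.
  exact: bmf_mxtrace.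
rewrite /mgf mean_extended_law; last first.
  apply: (bmf_comp (f := fun t => \tr (expmx (c *: deviation g t)))).
    exact: measurable_all_but_last.
  exact: bmf_mxtrace.
under [leRHS]eq_Rintegral do rewrite init_extended_sample -[\tr _]mulr1.
by rewrite (mean_prod P mu bs (bmf_cst _ 1)) mean_cst mulr1.
Qed.

End iid.

(** * Quadratic forms, whitening and the pseudoinverse *)

Section forms.
Variable R : realType.

Lemma spectral_sum_eigenvalue n (U : 'M[R]_n) a i : U *m U^T = 1%:M ->
  eigenvalue (spectral_sum U a) (a 0 i).
Proof.
move=> U1; apply/eigenvalueP; exists (row i U).
  rewrite -row_mul /spectral_sum !mulmxA U1 mul1mx.
  by rewrite row_mul row_diag_mx -scalemxAl -rowE.
apply/eqP => /(congr1 (fun v => v *m U^T)).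
rewrite -row_mul U1 mul0mx => /rowP/(_ i).
by rewrite !mxE eqxx => /eqP; rewrite oner_eq0.
Qed.

Lemma form_ge_eigenvalue n (A : 'M[R]_n) c u : A^T = A ->
  (forall a, eigenvalue A a -> c <= a) -> c * sqn u <= (u *m A *m u^T) 0 0.
Proof.
move=> /real_spectral[[U a] /= [U1 AE]] h.
have {}AE : A = spectral_sum U a by [].
rewrite AE spectral_sum_form mxE mulr1n -(sqn_orthogonal _ U1) /sqn mulr_sumr.
apply: ler_sum => i _; rewrite ler_wpM2r ?sqr_ge0// h// AE.
exact: spectral_sum_eigenvalue.
Qed.

Lemma form_le_eigenvalue n (A : 'M[R]_n) c u : A^T = A ->
  (forall a, eigenvalue A a -> a <= c) -> (u *m A *m u^T) 0 0 <= c * sqn u.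
Proof.
move=> /real_spectral[[U a] /= [U1 AE]] h.
have {}AE : A = spectral_sum U a by [].
rewrite AE spectral_sum_form mxE mulr1n -(sqn_orthogonal _ U1) /sqn mulr_sumr.
apply: ler_sum => i _; rewrite ler_wpM2r ?sqr_ge0// h// AE.
exact: spectral_sum_eigenvalue.
Qed.

(** In an eigenbasis, divide each coordinate by the square root of its eigenvalue; since eigenvalues
    are at least [c], squared norms grow by at most [1 / c]. *)
Lemma whitening n (A : 'M[R]_n) c : A^T = A -> 0 < c ->
  (forall a, eigenvalue A a -> c <= a) ->
  exists W : 'M[R]_n, W *m A *m W^T = 1%:M /\
    forall v : 'rV[R]_n, sqn (v *m W^T) <= c^-1 * sqn v.
Proof.
move=> /real_spectral[[U a] /= [U1 AE]] c0 h.
have ac i : c <= a 0 i.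
  by apply: h; rewrite AE; exact: spectral_sum_eigenvalue.
have a0 i : 0 < a 0 i by exact: lt_le_trans (ac i).
pose s : 'rV[R]_n := \row_i (Num.sqrt (a 0 i))^-1.
exists (diag_mx s *m U); split.
  rewrite AE trmx_mul tr_diag_mx !mulmxA -[diag_mx s *m U *m U^T]mulmxA U1 mulmx1.
  rewrite -[_ *m U *m U^T]mulmxA U1 mulmx1 !mulmx_diag -diag_const_mx; congr diag_mx.
  apply/rowP => i; rewrite !mxE mulrAC -expr2 exprVn sqr_sqrtr ?(ltW (a0 i))//.
  by rewrite mulVf// gt_eqF.
move=> v; rewrite trmx_mul tr_diag_mx mulmxA -[in leRHS](sqn_orthogonal _ U1).
move: (v *m U^T) => w; rewrite mul_mx_diag /sqn mulr_sumr; apply: ler_sum => i _.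
rewrite !mxE exprMn exprVn sqr_sqrtr ?(ltW (a0 i))// mulrC ler_wpM2r ?sqr_ge0//.
by rewrite lef_pV2 ?posrE.
Qed.

Lemma sqn_mul_tr m n (A : 'M[R]_(m, n)) (u : 'rV[R]_n) :
  sqn (u *m A^T) = (u *m (A^T *m A) *m u^T) 0 0.
Proof.
have := sqnE (u *m A^T); rewrite trmx_mul trmxK !mulmxA => ->.
by rewrite mxE mulr1n.
Qed.

Lemma gram_unitmx L n (A : 'M[R]_(L, n)) t : 0 < t -> smallest_sq_sv_ge A t ->
  A^T *m A \in unitmx.
Proof.
move=> t0 At; have symA : (A^T *m A)^T = A^T *m A by rewrite trmx_mul trmxK.
rewrite -row_free_unit -kermx_eq0; apply/eqP/row_matrixP => i; rewrite row0.
set u := row i _; apply/eqP; rewrite -sqn_eq0; apply/eqP.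
have uA : u *m (A^T *m A) = 0.
  by apply/sub_kermxP; exact: row_sub.
have := form_ge_eigenvalue u symA At; rewrite uA mul0mx mxE => h.
apply/eqP; rewrite eq_le sqn_ge0 andbT.
by rewrite -(pmulr_rle0 _ t0).
Qed.

(** [(A^T A)^-1 A^T] solves the Penrose equations, so [xget] returns a genuine solution rather than
    its default [0]. *)
Lemma mp_pinv_penrose L n (A : 'M[R]_(L, n)) : A^T *m A \in unitmx ->
  penrose A (mp_pinv A).
Proof.
move=> uA; pose G := A^T *m A.
apply: (@xgetI _ 0 [set B | penrose A B] (invmx G *m A^T)).
have symG : (invmx G)^T = invmx G by rewrite trmx_inv trmx_mul trmxK.
have BA : invmx G *m A^T *m A = 1%:M by rewrite -mulmxA mulVmx.
split.
- by rewrite -mulmxA BA mulmx1.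
- by rewrite BA mul1mx.
- by rewrite !trmx_mul symG trmxK mulmxA.
- by rewrite BA trmx1.
Qed.

(* [A B] is the orthogonal projection on the range of [A], hence a contraction. *)
Lemma mp_pinv_error L n (A : 'M[R]_(L, n)) t (z : 'cV[R]_L) (b : 'cV[R]_n) :
  0 < t -> smallest_sq_sv_ge A t ->
  t * sqn (mp_pinv A *m z - b)^T <= sqn (z - A *m b)^T.
Proof.
move=> t0 At; have uA := gram_unitmx t0 At.
have [ABA BAB symAB symBA] := mp_pinv_penrose uA; set B := mp_pinv A in ABA BAB symAB symBA *.
have BA : B *m A = 1%:M.
  have := congr1 (mulmx (invmx (A^T *m A) *m A^T)) ABA.
  by rewrite !mulmxA -[_ *m A^T *m A]mulmxA mulVmx// mul1mx.
have -> : B *m z - b = B *m (z - A *m b) by rewrite mulmxBr mulmxA BA mul1mx.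
move: (z - A *m b) => v.
have symA : (A^T *m A)^T = A^T *m A by rewrite trmx_mul trmxK.
apply: (le_trans (form_ge_eigenvalue (B *m v)^T symA At)).
rewrite -sqn_mul_tr -trmx_mul mulmxA.
pose Pr := A *m B.
have PP : Pr *m Pr = Pr by rewrite /Pr mulmxA ABA.
(* Pythagoras for the orthogonal projection [Pr]. *)
have : sqn (v - Pr *m v)^T = sqn v^T - sqn (Pr *m v)^T.
  have q (w : 'cV[R]_L) : sqn w^T = (w^T *m w) 0 0.
    by have := sqnE w^T; rewrite trmxK => ->; rewrite mxE mulr1n.
  rewrite !q [(_ - _)^T]raddfB /= mulmxBl !mulmxBr trmx_mul symAB -/Pr.
  rewrite -[v^T *m Pr *m (Pr *m v)]mulmxA [Pr *m (Pr *m v)]mulmxA PP.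
  by rewrite -[v^T *m Pr *m v]mulmxA subrr subr0 !mxE.
by have := sqn_ge0 (v - Pr *m v)^T => + E; rewrite E subr_ge0.
Qed.

End forms.

(** * Ill-conditioned designs *)

Section ill_conditioned.
Variable R : realType.

Lemma sum_outer_rows L n (E : 'M[R]_(L, n)) :
  E^T *m E = \sum_l (row l E)^T *m row l E.
Proof.
apply/matrixP => i j; rewrite mxE summxE; apply: eq_bigr => l _.
by rewrite !mxE big_ord_recl big_ord0 addr0 !mxE.
Qed.

(** Take an eigenvector [v] of [E^T E] with eigenvalue [a] below the threshold and write [v = u W].
    The form of the centred sum at [u] is [L |u|^2 - a |v|^2], which is at least [eps L |u|^2]
    because [c |v|^2 <= |u|^2]. *)
Lemma ill_conditioned_trace L n (E : 'M[R]_(L, n))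
    (A W : 'M[R]_n) (c eps th : R) :
  A^T = A -> 0 < c -> (forall a, eigenvalue A a -> c <= a) ->
  W *m A *m W^T = 1%:M -> 0 <= th -> eps <= 1 ->
  ~ smallest_sq_sv_ge E (L%:R * ((1 - eps) * c)) ->
  expR (th * (eps * L%:R)) <=
  \tr (expmx (th *: \sum_l (1%:M - (row l E *m W^T)^T *m (row l E *m W^T)))).
Proof.
move=> symA c0 Ac WAW th0 eps1 nE.
have [a ea a_lt] : exists2 a, eigenvalue (E^T *m E) a & a < L%:R * ((1 - eps) * c).
  apply/not_exists2P => h; apply: nE => a ea.
  by rewrite leNgt; apply/negP; have [] := h a.
have /eigenvalueP[v vE v0] := ea.
have Wu : W \in unitmx by have [] := mulmx1_unit (etrans (mulmxA _ _ _) WAW).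
pose u := v *m invmx W; have uW : u *m W = v by rewrite mulmxKV.
clearbody u; have u0 : u != 0 by apply: contraNneq v0 => u0; rewrite -uW u0 mul0mx.
have -> : \sum_l (1%:M - (row l E *m W^T)^T *m (row l E *m W^T)) =
    L%:R%:M - W *m (E^T *m E) *m W^T.
  rewrite sumrB sumr_const card_ord sum_outer_rows mulmx_sumr mulmx_suml.
  congr (_ - _); first by rewrite -scaler_nat scalemx1.
  by apply: eq_bigr => l _; rewrite trmx_mul trmxK !mulmxA.
set S := _ - _; have symS : S^T = S.
  by rewrite /S linearB /= tr_scalar_mx !trmx_mul !trmxK !mulmxA.
apply: (expR_le_mxtrace (u := u)) => //; first by rewrite linearZ /= symS.
rewrite -scalemxAr -scalemxAl mxE -mulrA ler_wpM2l//.
have -> : (u *m S *m u^T) 0 0 = L%:R * sqn u - a * sqn v.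
  have e1 : u *m S *m u^T = L%:R *: (u *m u^T) - a *: (v *m v^T).
    rewrite /S mulmxBr mulmxBl mul_mx_scalar -scalemxAl; congr (_ - _).
    rewrite !mulmxA uW -[v *m E^T *m E]mulmxA vE -!scalemxAl -mulmxA -trmx_mul.
    by rewrite uW.
  by rewrite e1 !sqnE !mxE !mulr1n.
(* Whitening identifies the squared norm of [u] with the [A]-form at [v]. *)
have uv : sqn u = (v *m A *m v^T) 0 0.
  transitivity ((u *m (W *m A *m W^T) *m u^T) 0 0).
    by rewrite WAW mulmx1 sqnE mxE mulr1n.
  by rewrite -uW trmx_mul !mulmxA.
have vA := form_ge_eigenvalue v symA Ac; rewrite -uv in vA.
have sv := sqn_ge0 v.
have h1 : a * sqn v <= L%:R * ((1 - eps) * c) * sqn v by rewrite ler_wpM2r// ltW.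
have h2 : L%:R * (1 - eps) * (c * sqn v) <= L%:R * (1 - eps) * sqn u.
  by rewrite ler_wpM2l// mulr_ge0// subr_ge0.
lra.
Qed.

End ill_conditioned.

(** * Support and quadratic risk *)

Section support.
Context (R : realType) (D : nat).

Definition cube (x : D.-tuple R) (r : R) : set (D.-tuple R) :=
  [set z | forall i, `|tnth z i - tnth x i| < r].

Lemma measurable_cube x r : measurable (cube x r).
Proof.
have -> : cube x r = \bigcap_(i in [set: 'I_D])
    ((fun z => `|tnth z i - tnth x i|) @^-1` `]-oo, r[).
  apply/seteqP; split => z /= h i; first by move=> _ /=; rewrite in_itv /=; exact: h.
  by have := h i Logic.I; rewrite /= in_itv.
apply: fin_bigcap_measurable; first exact: finite_finset.
move=> i _; rewrite -[X in measurable X]setTI.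
have mf : measurable_fun setT (fun z : D.-tuple R => `|tnth z i - tnth x i|).
  apply: measurableT_comp => //; apply: measurable_funB => //.
  exact: measurable_tnth.
exact: mf.
Qed.

(** Each point off the support lies in a null cube with rational centre and radius, and there are
    countably many of those. *)
Lemma not_supp_null (mu : probability (D.-tuple R) R) :
  exists N, [/\ measurable N, mu N = 0%E & ~` supp mu `<=` N].
Proof.
pose B (q : D.-tuple rat * rat) := cube [tuple ratr (tnth q.1 i) | i < D] (ratr q.2).
pose F n := if unpickle n is Some q then if mu (B q) == 0%E then B q else set0 else set0.
have mF n : measurable (F n).
  rewrite /F; case: unpickle => [q|//]; case: ifP => // _; exact: measurable_cube.
have F0 n : mu (F n) = 0%E.
  rewrite /F; case: unpickle => [q|]; last exact: measure0.
  by case: ifP => [/eqP//|_]; exact: measure0.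
exists (\bigcup_n F n); split.
- exact: bigcup_measurable.
- apply/negligibleP; first exact: bigcup_measurable.
  by apply: negligible_bigcup => n; exists (F n); split => //; exact: F0.
- move=> x /existsNP[r /not_implyP[r0 /negP]]; rewrite -leNgt => mur.
  have r2 : 0 < r / 2 by rewrite divr_gt0.
  (* A rational radius below [r / 2], with the centre within it of [x], keeps the rational cube
     inside the null cube around [x]. *)
  have [s /itvP sr] := rat_in_itvoo r2.
  have /choice[q qx] i : exists q : rat, ratr q \in `]tnth x i - ratr s, tnth x i + ratr s[.
    by apply: rat_in_itvoo; rewrite ltrBlDr -addrA ltrDl addr_gt0 ?sr.
  have qx' i : `|ratr (q i) - tnth x i| < ratr s by rewrite ltr_distl; have := qx i; rewrite in_itv.
  exists (pickle ([tuple q i | i < D], s)) => //; rewrite /F pickleK.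
  have -> : mu (B ([tuple q i | i < D], s)) == 0%E.
    rewrite eq_le measure_ge0 andbT; apply: le_trans mur.
    apply: le_measure; rewrite ?inE; [exact: measurable_cube|exact: (measurable_cube x r)|].
    move=> z zB i; have := zB i; rewrite !tnth_mktuple => zq.
    rewrite -(subrKA (ratr (q i))); apply: (le_lt_trans (ler_normD _ _)).
    have := qx' i; have sr2 : ratr s < r / 2 by rewrite sr.
    by move: zq; rewrite /=; lra.
  by move=> i; rewrite !tnth_mktuple distrC.
Qed.

End support.

(* The integral of a nonnegative function is a supremum over the simple functions
   below it, so the smaller function need not be measurable. *)
Lemma ge0_le_integral_nonmeasurable (d : measure_display) (S : measurableType d)
    (R : realType) (mu : {measure set S -> \bar R}) (f1 f2 : S -> \bar R) :
  (forall x, 0 <= f1 x)%E -> (forall x, f1 x <= f2 x)%E ->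
  (\int[mu]_x f1 x <= \int[mu]_x f2 x)%E.
Proof.
move=> f10 f12; have f20 x : (0 <= f2 x)%E by exact: le_trans (f12 x).
rewrite !ge0_integralTE//; apply: le_ereal_sup => _ [h hf <-].
by exists h => // x; exact: le_trans (hf x) (f12 x).
Qed.

Section integrable_sums.
Context (d : measure_display) (S : measurableType d) (R : realType).
Variable mu : {measure set S -> \bar R}.

Lemma integrable_sumR (I : Type) (s : seq I) (F : I -> S -> R) :
  (forall i, mu.-integrable setT (EFin \o F i)) ->
  mu.-integrable setT (EFin \o (fun x => \sum_(i <- s) F i x)).
Proof.
move=> iF; elim: s => [|i s IH].
  under eq_fun do rewrite big_nil; exact: integrable0.
under eq_fun do rewrite big_cons.
exact: (integrableD measurableT (iF i) IH).
Qed.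

Lemma integrableZlR (c : R) (f : S -> R) : mu.-integrable setT (EFin \o f) ->
  mu.-integrable setT (EFin \o (fun x => c * f x)).
Proof. by move=> iF; apply: (integrableZl measurableT c iF). Qed.

Lemma Rintegral_sum (I : Type) (s : seq I) (F : I -> S -> R) :
  (forall i, mu.-integrable setT (EFin \o F i)) ->
  \int[mu]_x (\sum_(i <- s) F i x) = \sum_(i <- s) \int[mu]_x F i x.
Proof.
move=> iF; elim: s => [|i s IH].
  under eq_Rintegral do rewrite big_nil.
  by rewrite big_nil Rintegral_cst// mul0r.
under eq_Rintegral do rewrite big_cons.
by rewrite big_cons RintegralD// ?IH//; exact: integrable_sumR.
Qed.

End integrable_sums.

(** * Population risk as a quadratic function of the coefficients *)

Section regression.
Context (R : realType) (D K : nat) (mu : probability (D.-tuple R) R)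
  (y : D.-tuple R -> R) (eta : 'I_K -> D.-tuple R -> R).
Hypothesis my : measurable_fun setT y.
Hypothesis iy : mu.-integrable setT (fun x => (y x ^+ 2)%:E).
Hypothesis beta : forall k, bmf (eta k).

Definition risk (a : 'rV[R]_K) : R := \int[mu]_x ((y x - \sum_k a 0 k * eta k x) ^+ 2).

Let b : 'rV[R]_K := \row_k \int[mu]_x (y x * eta k x).

Lemma tr_gram : (gram mu eta)^T = gram mu eta.
Proof.
by apply/matrixP => i j; rewrite !mxE; apply: eq_Rintegral => x _; rewrite mulrC.
Qed.

Lemma integrable_y_eta k : mu.-integrable setT (EFin \o (fun x => y x * eta k x)).
Proof.
have [mk [M kM]] := beta k.
have M0 : 0 <= M by apply: le_trans (kM point).
(* Domination through [|y| <= 1 + y^2]. *)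
apply: (@le_integrable _ _ _ mu setT _ _ (EFin \o (fun x => M * (1 + y x ^+ 2)))) => //.
- by apply/measurable_EFinP; exact: measurable_funM.
- move=> x _ /=; rewrite lee_fin normrM mulrC [leRHS]ger0_norm; last first.
    by rewrite mulr_ge0// addr_ge0// sqr_ge0.
  apply: ler_pM => //; have := sqr_ge0 (`|y x| - 1).
  have -> : y x ^+ 2 = `|y x| ^+ 2 by rewrite real_normK// num_real.
  have := normr_ge0 (y x); nra.
- apply: integrableZlR.
  exact: (integrableD measurableT (finite_measure_integrable_cst mu 1 measurableT) iy).
Qed.

Lemma integrable_eta_eta k j : mu.-integrable setT (EFin \o (fun x => eta k x * eta j x)).
Proof. by apply: bmf_integrable; exact: bmfM. Qed.

Lemma risk_expansion (a : 'rV[R]_K) x : (y x - \sum_k a 0 k * eta k x) ^+ 2 =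
  y x ^+ 2 + (\sum_k (-2 * a 0 k) * (y x * eta k x)
  + \sum_k \sum_j (a 0 k * a 0 j) * (eta k x * eta j x)).
Proof.
set s := \sum_k a 0 k * eta k x.
have -> : \sum_k (-2 * a 0 k) * (y x * eta k x) = -2 * y x * s.
  by rewrite mulr_sumr; apply: eq_bigr => k _; ring.
have -> : \sum_k \sum_j (a 0 k * a 0 j) * (eta k x * eta j x) = s * s.
  rewrite {1}/s mulr_suml; apply: eq_bigr => k _.
  by rewrite mulr_sumr; apply: eq_bigr => j _; ring.
ring.
Qed.

Let i1 (a : 'rV[R]_K) : mu.-integrable setT (EFin \o (fun x => \sum_k (-2 * a 0 k : R) * (y x * eta k x))).
Proof. by apply: integrable_sumR => k; apply: integrableZlR; exact: integrable_y_eta. Qed.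

Let i2 (a : 'rV[R]_K) : mu.-integrable setT (EFin \o (fun x => \sum_k \sum_j (a 0 k * a 0 j) * (eta k x * eta j x))).
Proof.
apply: integrable_sumR => k; apply: integrable_sumR => j.
by apply: integrableZlR; exact: integrable_eta_eta.
Qed.

Lemma integrable_risk (a : 'rV[R]_K) :
  mu.-integrable setT (EFin \o (fun x => (y x - \sum_k a 0 k * eta k x) ^+ 2)).
Proof.
under eq_fun do rewrite risk_expansion.
exact: (integrableD measurableT iy (integrableD measurableT (i1 a) (i2 a))).
Qed.

Lemma EFin_risk a :
  (risk a)%:E = (\int[mu]_x ((y x - \sum_k a 0 k * eta k x) ^+ 2)%:E)%E.
Proof.
rewrite /risk /Rintegral fineK//; exact: integrable_fin_num (integrable_risk a).
Qed.

Lemma riskE a : risk a =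
  \int[mu]_x (y x ^+ 2) - 2 * (a *m b^T) 0 0 + (a *m gram mu eta *m a^T) 0 0.
Proof.
rewrite /risk; under eq_Rintegral do rewrite risk_expansion.
rewrite RintegralD//; last exact: (integrableD measurableT (i1 a) (i2 a)).
rewrite RintegralD// -addrA; congr (_ + (_ + _)).
  rewrite Rintegral_sum; last by move=> k; apply: integrableZlR; exact: integrable_y_eta.
  rewrite mxE -mulNr mulr_sumr; apply: eq_bigr => k _.
  by rewrite !mxE RintegralZl//; [ring|exact: integrable_y_eta].
rewrite Rintegral_sum; last first.
  by move=> k; apply: integrable_sumR => j; apply: integrableZlR; exact: integrable_eta_eta.
rewrite -mulmxA mxE; apply: eq_bigr => k _; rewrite mxE mulr_sumr.
rewrite Rintegral_sum; last by move=> j; apply: integrableZlR; exact: integrable_eta_eta.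
apply: eq_bigr => j _; rewrite !mxE RintegralZl//; first by ring.
exact: integrable_eta_eta.
Qed.

(** Completing the square at the solution of the normal equations. *)
Lemma risk_minimizer : gram mu eta \in unitmx ->
  exists a0, forall a,
    risk a = risk a0 + ((a - a0) *m gram mu eta *m (a - a0)^T) 0 0.
Proof.
move=> uG; exists (b *m invmx (gram mu eta)) => a; rewrite !riskE.
set a0 := b *m _; have bE : b = a0 *m gram mu eta by rewrite mulmxKV.
have btE : b^T = gram mu eta *m a0^T by rewrite bE trmx_mul tr_gram.
rewrite btE [(a - a0)^T]raddfB /= mulmxBl mulmxBr !mulmxBl !mulmxA.
have sym1 (M : 'M[R]_1) : M^T = M by apply/matrixP => i j; rewrite !ord1 mxE.
have -> : a0 *m gram mu eta *m a^T = a *m gram mu eta *m a0^T.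
  by rewrite -[LHS]sym1 !trmx_mul trmxK tr_gram mulmxA.
move: (a *m _ *m a^T) (a *m _ *m a0^T) (a0 *m _ *m a0^T) => p q r.
rewrite !mxE; ring.
Qed.

End regression.

(** * The error bound *)

Section transfer.
Context (d d' : measure_display) (Omega : measurableType d) (T : measurableType d')
  (R : realType) (P : probability Omega R) (mu : probability T R) (X : Omega -> T).
Hypothesis mX : measurable_fun setT X.
Hypothesis lawX : forall A, measurable A -> P (X @^-1` A) = mu A.

Lemma ge0_integral_law (f : T -> R) : (forall x, 0 <= f x) -> measurable_fun setT f ->
  (\int[P]_w (f (X w))%:E = \int[mu]_x (f x)%:E)%E.
Proof.
move=> f0 mf; have mEf : measurable_fun setT (EFin \o f) by exact/measurable_EFinP.
have := @ge0_integral_pushforward _ _ _ _ _ _ mX P setT _ measurableT mEf (fun x _ => f0 x).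
rewrite preimage_setT => <-.
by apply: eq_measure_integral => A mA _; exact: lawX.
Qed.

Lemma integrable_law (f : T -> R) : (forall x, 0 <= f x) ->
  mu.-integrable setT (EFin \o f) -> P.-integrable setT (EFin \o (f \o X)).
Proof.
move=> f0 /integrableP[mf fi]; have {}mf : measurable_fun setT f by exact/measurable_EFinP.
apply/integrableP; split.
  by apply/measurable_EFinP; exact: measurableT_comp.
apply: le_lt_trans fi; under [leRHS]eq_integral do rewrite /= ger0_norm//.
rewrite -ge0_integral_law//.
by under eq_integral do rewrite /= ger0_norm//.
Qed.

Lemma Rintegral_law (f : T -> R) : (forall x, 0 <= f x) -> measurable_fun setT f ->
  \int[P]_w f (X w) = \int[mu]_x f x.
Proof. by move=> f0 mf; rewrite /Rintegral ge0_integral_law. Qed.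

End transfer.

(** * Whitened features bounded everywhere *)

Section whitened_features.
Context (R : realType) (D K : nat) (mu : probability (D.-tuple R) R)
  (eta : 'I_K -> D.-tuple R -> R) (c : R).
Hypothesis beta : forall k, bmf (eta k).
Hypothesis K_gt0 : (0 < K)%N.
Hypothesis c_gt0 : 0 < c.
Hypothesis eta_c : forall a, eigenvalue (gram mu eta) a -> c <= a.

Definition feature (x : D.-tuple R) : 'rV[R]_K := \row_k eta k x.
Let m := sup [set \sum_(k < K) `|eta k x| ^+ 2 | x in supp mu].

Lemma sqn_feature_le_sup x : supp mu x -> sqn (feature x) <= m.
Proof.
move=> sx; apply: ub_le_sup; last first.
  exists x => //; apply: eq_bigr => k _.
  by rewrite mxE real_normK// num_real.
have /choice[M hM] k : exists M : R, forall z, `|eta k z| <= M by exact: (beta k).2.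
exists (\sum_k M k ^+ 2) => _ [z _ <-]; apply: ler_sum => k _.
by rewrite lerXn2r ?nnegrE// (le_trans _ (hM k z)).
Qed.

Lemma mean_row_mul (v w : 'I_K -> R) :
  \int[mu]_x ((\sum_k eta k x * v k) * (\sum_k eta k x * w k)) =
  \sum_k \sum_j v k * gram mu eta k j * w j.
Proof.
have bb k j : bmf (fun x => (v k * w j) * (eta k x * eta j x)).
  by apply: bmfM; [exact: bmf_cst|exact: bmfM].
transitivity (\int[mu]_x (\sum_k \sum_j (v k * w j) * (eta k x * eta j x))).
  apply: eq_Rintegral => x _; rewrite mulr_suml; apply: eq_bigr => k _.
  by rewrite mulr_sumr; apply: eq_bigr => j _; ring.
rewrite mean_sum; last by move=> k; apply: bmf_sum.
apply: eq_bigr => k _; rewrite mean_sum//; apply: eq_bigr => j _.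
by rewrite meanZ; [rewrite mxE; ring|exact: bmfM].
Qed.

(** The bound by [m] holds on the support only. Setting the features to zero on a null set covering
    its complement makes it hold everywhere and leaves second moments unchanged. *)
Lemma whitened_features : exists (W : 'M[R]_K) (N : set (D.-tuple R)),
  let g x := \1_(~` N) x *: (feature x *m W^T) in
  [/\ measurable N, mu N = 0%E & W *m gram mu eta *m W^T = 1%:M] /\
  [/\ 0 < m, (forall k, measurable_fun setT (fun x => g x 0 k)),
      (forall x, sqn (g x) <= m / c) &
      forall i j, \int[mu]_x (g x 0 i * g x 0 j) = (i == j)%:R].
Proof.
have [W [WGW Wle]] := whitening (tr_gram mu eta) c_gt0 eta_c.
have [N [mN N0 suppN]] := not_supp_null mu.
exists W, N => g.
have m_ge0 : 0 <= m.
  have [x xN] : exists x, ~ N x.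
    apply/existsNP => allN; have NT : N = setT by apply/seteqP; split.
    have := @probability_setT _ _ _ mu; rewrite -NT N0 => /eqP.
    by rewrite eqe eq_sym oner_eq0.
  have sx : supp mu x by apply: contrapT => /suppN.
  exact: le_trans (sqn_ge0 _) (sqn_feature_le_sup sx).
have gN x : ~ N x -> g x = feature x *m W^T.
  by move=> xN; rewrite /g indicE mem_set// scale1r.
have gE x k : g x 0 k = \1_(~` N) x * \sum_j eta j x * W k j.
  rewrite !mxE; congr (_ * _); apply: eq_bigr => j _; by rewrite !mxE.
have bsum k : bmf (fun x => \sum_j eta j x * W k j).
  by apply: bmf_sum => j; apply: bmfM => //; exact: bmf_cst.
have b1 : bmf (\1_(~` N) : D.-tuple R -> R).
  split; first by apply: measurable_indic; exact: measurableC.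
  by exists 1 => x; rewrite indicE; case: (x \in _); rewrite ?normr1 ?normr0.
have bg k : bmf (fun x => g x 0 k).
  by under eq_fun do rewrite gE; exact: bmfM.
have gm x : sqn (g x) <= m / c.
  have [xN|xN] := pselect (N x).
    rewrite /g indicE memNset; last by move=> /(_ xN).
    by rewrite sqnZ expr0n mul0r divr_ge0// ltW.
  rewrite gN//; apply: (le_trans (Wle _)); rewrite mulrC ler_wpM2r ?invr_ge0 ?(ltW c_gt0)//.
  by apply: sqn_feature_le_sup; apply: contrapT => /suppN.
have gid i j : \int[mu]_x (g x 0 i * g x 0 j) = (i == j)%:R.
  transitivity (\int[mu]_x ((\sum_k eta k x * W i k) * (\sum_k eta k x * W j k))).
    rewrite /Rintegral; congr fine; apply: ae_eq_integral => //.
    - by apply/measurable_EFinP; exact: (bmfM (bg i) (bg j)).1.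
    - by apply/measurable_EFinP; exact: (bmfM (bsum i) (bsum j)).1.
    - exists N; split => // x /= /not_implyP[_ h]; apply: contrapT => xN; apply: h.
      by rewrite !gE indicE mem_set// !mul1r.
  rewrite mean_row_mul; have /matrixP/(_ i j) := WGW; rewrite !mxE => <-.
  rewrite exchange_big; apply: eq_bigr => k _; rewrite !mxE mulr_suml.
  by apply: eq_bigr => l _; rewrite mxE.
split => //; split => //; last by move=> k; exact: (bg k).1.
(* If [m] were zero, the features would vanish, although their mean squared norm is [K]. *)
rewrite lt_def m_ge0 andbT; apply/eqP => m0.
have : \int[mu]_x sqn (g x) <= \int[mu]_x (m / c).
  by apply: le_mean => //; [apply: bmf_sum => i; exact: bmfM|exact: bmf_cst].
rewrite mean_cst m0 mul0r /sqn mean_sum; last by move=> i; exact: bmfM.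
have -> : \sum_i \int[mu]_x (g x 0 i ^+ 2) = \sum_(i < K) 1.
  apply: eq_bigr => i _; transitivity ((i == i)%:R : R); last by rewrite eqxx.
  rewrite -gid.
  by apply: eq_Rintegral => x _; rewrite expr2.
by rewrite sumr_const card_ord lern0 -leqn0 leqNgt K_gt0.
Qed.

End whitened_features.

(** The left side equals [- 3 eps^2 L / (6 m / c)], and the required denominator is at least
    [6 m / c] because [c <= hi]. *)
Lemma exponent_le (R : realType) (c hi eps m : R) (L : nat) :
  0 < c -> c <= hi -> 0 < eps -> 0 < m ->
  - (eps / (m / c) * (eps * L%:R)) + (eps / (m / c)) ^+ 2 * (m / c * L%:R) / 2 <=
  - (3 * eps ^+ 2 * L%:R) / (6 * m * hi / c ^+ 2 + 2 * eps * (m / c + hi / c)).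
Proof.
move=> c0 chi e0 m0; have hi0 : 0 < hi by exact: lt_le_trans chi.
set den := 6 * m * hi / c ^+ 2 + _.
have -> : - (eps / (m / c) * (eps * L%:R)) + (eps / (m / c)) ^+ 2 * (m / c * L%:R) / 2 =
    - (3 * eps ^+ 2 * L%:R) / (6 * (m / c)).
  by field; rewrite !gt_eqF.
have den_ge : 6 * (m / c) <= den.
  rewrite /den; apply: (@le_trans _ _ (6 * m * hi / c ^+ 2)); last first.
    by rewrite lerDl !mulr_ge0 ?addr_ge0 ?divr_ge0// ltW.
  rewrite -[6 * m * hi]mulrA -[6 * _ / _]mulrA ler_pM2l// -[m * hi / _]mulrA ler_pM2l//.
  by rewrite expr2 invfM mulrA -[leLHS]mul1r ler_pM2r ?invr_gt0// ler_pdivlMr// mul1r.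
rewrite !mulNr lerN2; apply: ler_wpM2l; first by rewrite mulr_ge0// mulr_ge0// sqr_ge0.
have m6 : 0 < 6 * (m / c) by rewrite mulr_gt0// divr_gt0.
by rewrite lef_pV2// posrE; exact: lt_le_trans den_ge.
Qed.

Theorem theorem4p1 (R : realType) (d : measure_display) (Omega : measurableType d)
  (P : probability Omega R) (D K L : nat) (mu : probability (D.-tuple R) R)
  (X : 'I_L -> Omega -> D.-tuple R)
  (y : D.-tuple R -> R) (eta : 'I_K -> D.-tuple R -> R)
  (lam_lo lam_hi eps : R) :
  (0 < K)%N ->
  (forall l, measurable_fun setT (X l)) ->
  (forall l A, measurable A -> P (X l @^-1` A) = mu A) ->
  mutually_independent P X ->
  measurable_fun setT y ->
  mu.-integrable setT (fun x => (y x ^+ 2)%:E) ->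
  (forall k, measurable_fun setT (eta k)) ->
  (forall k, mu.-integrable setT (fun x => (eta k x ^+ 2)%:E)) ->
  \rank (gram mu eta) = K ->
  0 < lam_lo ->
  (forall a, eigenvalue (gram mu eta) a -> lam_lo <= a <= lam_hi) ->
  (exists M : R, forall k x, `|eta k x| <= M) ->
  0 < eps < 1 ->
  let m := sup [set \sum_(k < K) `|eta k x| ^+ 2 | x in supp mu] in
  let tau := (1 - eps) * lam_lo in
  (\int[P]_w \int[mu]_x
      ((y x - alg2 eta tau (fun l => X l w) (\col_(l < L) y (X l w)) x) ^+ 2)%:E
   <= (1 + lam_hi / (lam_lo * (1 - eps)))%:E *
        ereal_inf [set \int[mu]_x ((y x - \sum_(k < K) a k ord0 * eta k x) ^+ 2)%:E
                  | a in [set: 'cV[R]_K]]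
      + (2 * K%:R * expR (- (3 * eps ^+ 2 * L%:R) /
            (6 * m * lam_hi / lam_lo ^+ 2
             + 2 * eps * (m / lam_lo + lam_hi / lam_lo))))%:E
        * \int[mu]_x (y x ^+ 2)%:E)%E.
Proof.
move=> K0 mX lawX indX my iy meta _ rankG c0 Geig [M etaM] /andP[e0 e1]; cbv zeta.
set m := sup _; set tau := (1 - eps) * lam_lo.
have beta k : bmf (eta k) by split=> //; exists M.
have tau0 : 0 < tau by rewrite mulr_gt0// subr_gt0.
set G := gram mu eta in rankG Geig.
have symG : G^T = G by exact: tr_gram.
have uG : G \in unitmx by rewrite -row_free_unit /row_free rankG.
have Glo a : eigenvalue G a -> lam_lo <= a by move=> /Geig/andP[].
have Ghi a : eigenvalue G a -> a <= lam_hi by move=> /Geig/andP[].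
(* Since [K] is positive, some eigenvalue exists between the two bounds. *)
have chi : lam_lo <= lam_hi.
  have [a /Geig/andP[]] : exists a, eigenvalue G a.
    move: K0 => /prednK K0; move: (G) symG; rewrite -K0 => ? ?.
    exact: symmetric_eigenvalue_exists.
  exact: le_trans.
have hi0 : 0 < lam_hi by exact: lt_le_trans chi.
have [W [N [[mN N0 WGW] [m0 mg' gm' gid']]]] := whitened_features beta K0 c0 Glo.
pose g x : 'rV[R]_K := \1_(~` N) x *: (feature eta x *m W^T).
have mg k : measurable_fun setT (fun x => g x 0 k) by exact: mg'.
have gm x : sqn (g x) <= m / lam_lo by exact: gm'.
have gid i j : \int[mu]_x (g x 0 i * g x 0 j) = (i == j)%:R by exact: gid'.
rewrite -/m in m0.
have [a0 riskE0] := risk_minimizer my iy beta uG.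
pose J := risk mu y eta; pose J0 := J a0; pose c2 := J 0.
have J_ge0 a : 0 <= J a by apply: Rintegral_ge0 => x _; exact: sqr_ge0.
have J0_ge0 : 0 <= J0 := J_ge0 a0.
have c2_ge0 : 0 <= c2 := J_ge0 0.
have c2E : (\int[mu]_x (y x ^+ 2)%:E)%E = c2%:E.
  rewrite /c2 /J EFin_risk//; apply: eq_integral => x _.
  by rewrite big1 ?subr0// => k _; rewrite mxE mul0r.
set B := expR _; set I := ereal_inf _.
have I_ge : (J0%:E <= I)%E.
  apply: le_ereal_inf_tmp => _ [a _ <-].
  rewrite (_ : (\int[mu]_x _)%E = (J a^T)%:E).
    rewrite lee_fin /J riskE0 lerDl.
    apply: le_trans (form_ge_eigenvalue _ symG Glo).
    by rewrite mulr_ge0 ?sqn_ge0// ltW.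
  rewrite /J EFin_risk//; apply: eq_integral => x _.
  by under [in RHS]eq_bigr do rewrite mxE.
rewrite c2E.
suff main : (\int[P]_w \int[mu]_x
      ((y x - alg2 eta tau (fun l => X l w) (\col_(l < L) y (X l w)) x) ^+ 2)%:E <=
    (J0 * (1 + lam_hi / tau) + 2 * K%:R * B * c2)%:E)%E.
  apply: (le_trans main); rewrite EFinD [(2 * K%:R * B * c2)%:E]EFinM leeD2r//.
  rewrite mulrC EFinM [lam_lo * _]mulrC lee_wpmul2l// lee_fin.
  by rewrite addr_ge0// divr_ge0// ltW.
pose coef w := (alg2_coef eta tau (fun l => X l w) (\col_(l < L) y (X l w)))^T.
have innerE w : (\int[mu]_x
      ((y x - alg2 eta tau (fun l => X l w) (\col_(l < L) y (X l w)) x) ^+ 2)%:E)%E =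
    (J (coef w))%:E.
  rewrite /J EFin_risk//; apply: eq_integral => x _; rewrite /alg2.
  by under [in RHS]eq_bigr do rewrite mxE.
under eq_integral do rewrite innerE.
(* Without samples the threshold [L tau] is zero and cannot be divided by. The estimator is then
   zero and [B = 1], so the second term alone suffices. *)
have [L0|L0] := posnP L.
  have coef0 w : coef w = 0.
    rewrite /coef /alg2_coef; case: ifP => _; last by rewrite trmx0.
    set Y := \col_l _; have -> : Y = 0.
      by apply/matrixP => l; have := ltn_ord l; rewrite {2}L0.
    by rewrite mulmx0 trmx0.
  under eq_integral do rewrite coef0.
  rewrite integral_cst// -/c2 [X in (_ * X)%E](_ : _ = 1%E); last exact: probability_setT.
  rewrite mule1 lee_fin.
  have -> : B = 1 by rewrite /B L0 mulr0 oppr0 mul0r expR0.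
  rewrite mulr1; apply: (@le_trans _ _ (2 * K%:R * c2)).
    have K1 : 1 <= K%:R :> R by rewrite ler1n.
    by apply: ler_peMl => //; lra.
  by rewrite lerDr mulr_ge0// addr_ge0// divr_ge0// ltW.
have L0' : 0 < L%:R :> R by rewrite ltr0n.
have Lt0 : 0 < L%:R * tau by exact: mulr_gt0.
have cS0 : 0 <= lam_hi / (L%:R * tau) by apply: divr_ge0; exact: ltW.
(* This minimizes [- th eps L + th^2 (m / lam_lo) L / 2]. *)
pose th := eps / (m / lam_lo).
have th0 : 0 <= th by rewrite !divr_ge0// ltW.
pose e2 x := (y x - \sum_k a0 0 k * eta k x) ^+ 2.
pose tr w := \tr (expmx (th *: deviation g (sample X w))).
(* An integrable pointwise majorant of the risk. Its terms cover the minimal risk, the least-squares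
   error, an ill-conditioned design, and samples in the null set [N]; it avoids any measurability
   claim about the estimator. *)
pose U w := J0 + (lam_hi / (L%:R * tau) * (\sum_l e2 (X l w)) +
   c2 * (expR (- (th * (eps * L%:R))) * tr w + \sum_l \1_N (X l w))).
have tr_ge0 w : 0 <= tr w.
  apply: mxtrace_expmx_ge0; exact: tr_scaled_deviation.
have fU w : J (coef w) <= U w.
  set E := design_matrix eta (fun l => X l w).
  have s1 : 0 <= \sum_l \1_N (X l w) :> R by apply: sumr_ge0 => l _; rewrite indicE.
  have s2 : 0 <= expR (- (th * (eps * L%:R))) * tr w by rewrite mulr_ge0 ?expR_ge0.
  have s3 : 0 <= \sum_l e2 (X l w) by apply: sumr_ge0 => l _; exact: sqr_ge0.
  have [good|bad] := pselect (smallest_sq_sv_ge E (L%:R * tau)).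
    have coefE : coef w = (mp_pinv E *m (\col_(l < L) y (X l w)))^T.
      by rewrite /coef /alg2_coef asboolT.
    rewrite /J riskE0 /U lerD2l -[leLHS]addr0 lerD//; last by rewrite mulr_ge0 ?addr_ge0.
    apply: (le_trans (form_le_eigenvalue _ symG Ghi)).
    rewrite -mulrA ler_pM2l// mulrC ler_pdivlMr// mulrC.
    have := mp_pinv_error (\col_(l < L) y (X l w)) a0^T Lt0 good.
    rewrite [(_ - a0^T)^T]raddfB /= trmxK -coefE => h; apply: (le_trans h).
    rewrite le_eqVlt; apply/orP; left; apply/eqP; apply: eq_bigr => l _.
    rewrite !mxE /e2; congr ((_ - _) ^+ 2); apply: eq_bigr => k _.
    by rewrite !mxE mulrC.
  have coefE : coef w = 0 by rewrite /coef /alg2_coef asboolF// trmx0.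
  rewrite coefE -/c2 /U; apply: (@le_trans _ _ (c2 * 1)); first by rewrite mulr1.
  rewrite addrA -[leLHS]add0r; apply: lerD.
    by rewrite addr_ge0// mulr_ge0.
  apply: ler_wpM2l => //.
  (* A sample in [N] already makes the indicator sum at least one; otherwise [g] agrees with the
     whitened features on the whole sample. *)
  have [[l lN]|noN] := pselect (exists l, N (X l w)).
    rewrite (bigD1 l)//= indicE mem_set// addrCA lerDl addr_ge0//.
    by apply: sumr_ge0 => j _; rewrite indicE.
  rewrite -[leLHS]addr0 lerD// expRN mulrC ler_pdivlMr ?expR_gt0// mul1r.
  have := ill_conditioned_trace symG c0 Glo WGW th0 (ltW e1) bad.
  congr (_ <= _); rewrite /tr /deviation; congr (\tr (expmx (_ *: _))).
  apply: eq_bigr => l _; rewrite /outer /g /sample tnth_mktuple.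
  rewrite indicE mem_set ?scale1r; last by move=> Nl; apply: noN; exists l.
  have -> // : row l E = feature eta (X l w).
  by apply/rowP => k; rewrite !mxE.
have ie2 : mu.-integrable setT (EFin \o e2) by exact: integrable_risk.
have me2 : measurable_fun setT e2 by case/integrableP: ie2 => /measurable_EFinP.
have e2_ge0 x : 0 <= e2 x by exact: sqr_ge0.
have bdev := bmfmx_expmx_deviation L mg gm th0.
have btr : bmf tr.
  apply: (bmf_comp (f := fun t => \tr (expmx (th *: deviation g t)))).
    exact: measurable_sample.
  exact: bmf_mxtrace.
have b1 : bmf (\1_N : D.-tuple R -> R).
  split; first exact: measurable_indic.
  by exists 1 => x; rewrite indicE; case: (x \in _); rewrite ?normr1 ?normr0.
have b1X l : bmf (fun w => \1_N (X l w) : R) by exact: (bmf_comp (mX l) b1).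
have bT : bmf (fun w => c2 * (expR (- (th * (eps * L%:R))) * tr w + \sum_l \1_N (X l w))).
  apply: bmfM; first exact: bmf_cst.
  apply: bmfD; last exact: bmf_sum.
  by apply: bmfM => //; exact: bmf_cst.
have ie2X l : P.-integrable setT (EFin \o (fun w => e2 (X l w))).
  exact: (integrable_law (mX l) (lawX l)).
have iS : P.-integrable setT (EFin \o (fun w => \sum_l e2 (X l w))).
  exact: integrable_sumR.
have iZ := integrableZlR (lam_hi / (L%:R * tau)) iS.
have iT := bmf_integrable P bT.
have iZT : P.-integrable setT (EFin \o (fun w => lam_hi / (L%:R * tau) * (\sum_l e2 (X l w)) +
   c2 * (expR (- (th * (eps * L%:R))) * tr w + \sum_l \1_N (X l w)))).
  exact: (integrableD measurableT iZ iT).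
have iJ : P.-integrable setT (EFin \o (fun _ : Omega => J0)).
  exact: bmf_integrable (bmf_cst _ J0).
have iU : P.-integrable setT (EFin \o U) by exact: (integrableD measurableT iJ iZT).
have intU : \int[P]_w U w <= J0 * (1 + lam_hi / tau) + 2 * K%:R * B * c2.
  rewrite /U RintegralD// RintegralD// mean_cst RintegralZl// Rintegral_sum//.
  (* Each residual has mean [J0], so the factor [1 / (L tau)] leaves [lam_hi / tau] times [J0]. *)
  have -> : \sum_l \int[P]_w e2 (X l w) = L%:R * J0.
    under eq_bigr => l _ do rewrite (Rintegral_law (mX l) (lawX l) e2_ge0 me2).
    by rewrite sumr_const card_ord mulr_natl.
  have btr' : bmf (fun w => expR (- (th * (eps * L%:R))) * tr w).
    by apply: bmfM => //; exact: bmf_cst.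
  rewrite meanZ; last by apply: bmfD => //; exact: bmf_sum.
  rewrite meanD//; last exact: bmf_sum.
  have null : \int[P]_w (\sum_l \1_N (X l w)) = 0 :> R.
    rewrite mean_sum//; apply: big1 => l _.
    have ind_ge0 x : 0 <= \1_N x :> R by rewrite indicE.
    rewrite (Rintegral_law (mX l) (lawX l) ind_ge0 b1.1).
    rewrite /Rintegral integral_indic// setIT -[RHS]/(fine 0%E); congr fine; exact: N0.
  rewrite meanZ// null.
  rewrite addr0 addrA lerD//.
    rewrite le_eqVlt; apply/orP; left; apply/eqP.
    by field; rewrite !gt_eqF.
  rewrite mulrC ler_wpM2r//.
  (* The Markov factor times the trace bound produces the exponent treated by [exponent_le]. *)
  have := sample_mgf_bound mX lawX indX mg gm gid th0; rewrite -/(tr _) => h.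
  apply: (@le_trans _ _ (expR (- (th * (eps * L%:R))) *
      (2 * K%:R * expR (th ^+ 2 * (m / lam_lo * L%:R) / 2)))).
    by rewrite ler_wpM2l ?expR_ge0.
  rewrite mulrCA -expRD ler_wpM2l// ler_expR.
  exact: exponent_le.
apply: (@le_trans _ _ (\int[P]_w (U w)%:E)%E).
  apply: ge0_le_integral_nonmeasurable => w; first by rewrite lee_fin.
  by rewrite lee_fin.
by rewrite -(fineK (integrable_fin_num measurableT iU)) lee_fin.
Qed.
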